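(* Let $\mathcal{X}$ be either $\mathbb{R}^n$ or a closed cube $Q_0\subsetneqq\mathbb{R}^n$. Let $1\le q<p<\infty$, $s\in\mathbb{Z}_+$ and $\alpha\in[0,\infty)$. Then $JN_{(p,q,s)_\alpha}(\mathcal{X})=JN_{(p,1,s)_\alpha}(\mathcal{X})$ with equivalent norms.
   Context: $\mathbb{Z}_+$ is the set of non-negative integers. Cubes in $\mathbb{R}^n$ have edges parallel to the coordinate axes and finite positive edge length. For $s\in\mathbb{Z}_+$, a cube $Q$ and an integrable $f$, $P_Q^{(s)}(f)$ denotes the unique polynomial of degree not greater than $s$ such that $\int_Q[f(x)-P_Q^{(s)}(f)(x)]x^\gamma\,dx=0$ for all multi-indices $\gamma\in\mathbb{Z}_+^n$ with $|\gamma|\le s$. $L^1_{\mathrm{loc}}(\mathcal{X})$ is the set of measurable $f$ with $f\mathbf 1_E\in L^1(\mathcal{X})$ for every bounded $E\subset\mathcal{X}$. John--Nirenberg--Campanato space: for $p\in(1,\infty)$, $q\in[1,\infty)$, $s\in\mathbb{Z}_+$, $\alpha\in[0,\infty)$, $JN_{(p,q,s)_\alpha}(\mathcal{X})$ is the set of $f\in L^1_{\mathrm{loc}}(\mathcal{X})$ with $$\|f\|_{JN_{(p,q,s)_\alpha}(\mathcal{X})}:=\sup\left\{\sum_i|Q_i|\left[|Q_i|^{-\alpha}\left(\frac1{|Q_i|}\int_{Q_i}|f-P_{Q_i}^{(s)}(f)|^q\right)^{1/q}\right]^p\right\}^{1/p}<\infty,$$ the supremum being over all collections of pairwise disjoint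 cubes $\{Q_i\}_i$ in $\mathcal{X}$. *)

(* Defs.v *)
From HB Require Import structures.
From mathcomp Require Import all_boot all_order all_algebra.
From mathcomp Require Import all_classical all_reals all_analysis.
From mathcomp Require mpoly.
(* The notations of mpoly clash with those of the analysis library. *)
Import (coercions, canonicals) mpoly.

Set Implicit Arguments.
Unset Strict Implicit.
Unset Printing Implicit Defensive.

Import Order.TTheory GRing.Theory Num.Theory.
Import numFieldNormedType.Exports.

Local Open Scope classical_set_scope.
Local Open Scope ring_scope.

Section product_cons.
Context d (T : measurableType d) (R : realType) (n : nat).
Variable m1 : {sigma_finite_measure set T -> \bar R}.
Variable m2 : {sigma_finite_measure set (n.-tuple T) -> \bar R}.

Definition tuple_of_pair (z : T * n.-tuple T) : n.+1.-tuple T :=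
  [the n.+1.-tuple T of z.1 :: z.2].

Let measurable_tuple_of_pair : measurable_fun setT tuple_of_pair.
Proof. exact: measurable_cons. Qed.

Definition product_cons : set (n.+1.-tuple T) -> \bar R :=
  pushforward (m1 \x m2)%E tuple_of_pair.

Let product_cons0 : product_cons set0 = 0%E.
Proof. by rewrite /product_cons /pushforward preimage_set0 measure0. Qed.

Let product_cons_ge0 A : (0 <= product_cons A)%E.
Proof. exact: measure_ge0. Qed.

Let product_cons_sigma_additive : semi_sigma_additive product_cons.
Proof.
move=> F mF tF mUF; rewrite /product_cons /pushforward preimage_bigcup.
apply: measure_semi_sigma_additive.
- by move=> k; rewrite -[X in measurable X]setTI; exact: measurable_tuple_of_pair.
- apply/trivIsetP => /= i j _ _ ij; rewrite -preimage_setI.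
  by move/trivIsetP : tF => /(_ _ _ _ _ ij) ->//; rewrite preimage_set0.
- rewrite -preimage_bigcup -[X in measurable X]setTI.
  exact: measurable_tuple_of_pair.
Qed.

HB.instance Definition _ := isMeasure.Build _ _ _ product_cons
  product_cons0 product_cons_ge0 product_cons_sigma_additive.

Let product_cons_sigma_finite : sigma_finite setT product_cons.
Proof.
have /sigma_finiteP[F [TF ndF Foo]] := sigma_finiteT m1.
have /sigma_finiteP[G [TG ndG Goo]] := sigma_finiteT m2.
pose g (t : n.+1.-tuple T) : T * n.-tuple T := (thead t, [tuple of behead t]).
have mg : measurable_fun setT g.
  by apply/measurable_fun_pairP; split;
    [exact: measurable_tnth|exact: measurable_behead].
exists (fun k => g @^-1` (F k `*` G k)).
  rewrite -preimage_bigcup; apply/seteqP; split=> // t _ /=.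
  have : setT (g t).1 by []; rewrite TF => -[i _ Fi].
  have : setT (g t).2 by []; rewrite TG => -[j _ Gj].
  exists (maxn i j) => //; split.
  - by move: Fi; exact/subsetPset/ndF/leq_maxl.
  - by move: Gj; exact/subsetPset/ndG/leq_maxr.
move=> k; have [mF Fk] := Foo k; have [mG Gk] := Goo k; split.
  by rewrite -[X in measurable X]setTI; apply: mg => //; exact: measurableX.
rewrite /product_cons /pushforward -comp_preimage.
rewrite (_ : g \o tuple_of_pair = id); last first.
  by apply/funext => -[x t]; congr pair; apply/val_inj.
by rewrite preimage_id product_measure1E// lte_mul_pinfty// ge0_fin_numE.
Qed.

HB.instance Definition _ :=
  Measure_isSigmaFinite.Build _ _ _ product_cons product_cons_sigma_finite.

End product_cons.

Fixpoint lebesgue_borel (R : realType) (n : nat) :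
    {sigma_finite_measure set (n.-tuple (measurableTypeR R)) -> \bar R} :=
  match n with
  | 0 => \d_ [tuple]
  | n'.+1 => product_cons (@lebesgue_measure R) (lebesgue_borel R n')
  end.

(* R^n carries the Lebesgue (completed Borel) sigma-algebra, so that
   measurability of functions on it is Lebesgue measurability. *)
Definition euclidean (R : realType) (n : nat) : measurableType _ :=
  caratheodory_type (lebesgue_borel R n)^*%mu.

Definition lebesgue (R : realType) (n : nat) :
    {measure set (euclidean R n) -> \bar R} :=
  @completed_measure_extension _ _ _ (lebesgue_borel R n).

Section campanato.
Context (R : realType) (n : nat).
Local Notation E := (euclidean R n).
Local Notation mu := (lebesgue R n).

Definition coordinate (x : E) (i : 'I_n) : R := tnth (x : n.-tuple R) i.

(* Each face of a cube may or may not belong to it; [BSide true a] as a lower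
   bound and [BSide false b] as an upper bound include the endpoint. *)
Definition is_cube (Q : set E) : Prop :=
  exists (a : 'I_n -> R) (l : R) (lo hi : 'I_n -> bool), 0 < l /\
    Q = [set x | forall i, coordinate x i \in
           Interval (BSide (lo i) (a i)) (BSide (hi i) (a i + l))].

Definition is_closed_cube (Q : set E) : Prop :=
  exists (a : 'I_n -> R) (l : R), 0 < l /\
    Q = [set x | forall i, a i <= coordinate x i <= a i + l].

Definition euclidean_bounded (A : set E) : Prop :=
  exists M : R, forall x, A x -> forall i, `|coordinate x i| <= M.

Definition volume (Q : set E) : R := fine (mu Q).

(* Functions are total; only their restriction to X is constrained. *)
Definition L1loc (X : set E) : set (E -> R) :=
  [set f : E -> R | measurable_fun X f /\
     forall A, measurable A -> A `<=` X -> euclidean_bounded A ->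
       mu.-integrable X (fun x => (f x * \1_A x)%:E)].

(* [msize] is the total degree plus one, and 0 for the zero polynomial. *)
Definition is_moment_projection (s : nat) (f : E -> R) (Q : set E)
    (P : mpoly.mpoly n R) : Prop :=
  (mpoly.msize P <= s.+1)%N /\
  forall g : mpoly.multinom n, (mpoly.mdeg g <= s)%N ->
    (\int[mu]_(x in Q)
       ((f x - mpoly.meval (coordinate x) P) * \prod_(i < n) coordinate x i ^+ g i)%:E
     = 0)%E.

(* For f integrable on a cube Q this is the unique such polynomial. *)
Definition moment_projection (s : nat) (f : E -> R) (Q : set E) :
    mpoly.mpoly n R :=
  xget 0 (is_moment_projection s f Q).

Local Open Scope ereal_scope.

(* The L^q mean of f - P_Q^(s)(f) over Q; [\bar R]-valued since it may be +oo. *)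
Definition campanato_oscillation (q : R) (s : nat) (f : E -> R) (Q : set E) : \bar R :=
  ((volume Q)^-1%:E *
   \int[mu]_(x in Q)
     (`|f x - mpoly.meval (coordinate x) (moment_projection s f Q)| `^ q)%:E)
  `^ q^-1.

Definition disjoint_cubes (X : set E) (C : set (set E)) : Prop :=
  C `<=` [set Q | is_cube Q /\ Q `<=` X] /\ trivIset C id.

Definition JN_norm (X : set E) (p q : R) (s : nat) (alpha : R) (f : E -> R) :
    \bar R :=
  ereal_sup [set \esum_(Q in C)
      ((volume Q)%:E *
       (((volume Q) `^ (- alpha))%:E * campanato_oscillation q s f Q) `^ p)
    | C in disjoint_cubes X] `^ p^-1.

Definition JN (X : set E) (p q : R) (s : nat) (alpha : R) : set (E -> R) :=
  [set f | L1loc X f /\ JN_norm X p q s alpha f < +oo].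

End campanato.

(* Main.v *)
(** A Calderon-Zygmund argument.  Write u_Q = |f - P_Q f|, let a(Q) be its mean over
    Q and r = q / p.  For a level L a(Q), the maximal dyadic subcubes F_m of Q on which
    the mean of u_Q exceeds that level have total volume at most |Q| / L; off their
    union u_Q <= L a(Q) almost everywhere, and on F_m the polynomials P_Q f and P_{F_m} f
    differ by at most a constant times a(Q).  Hence
      int_Q u_Q^q <= K a(Q)^q |Q| + 2^q sum_m int_{F_m} u_{F_m}^q.
    If W is superadditive on disjoint cubes and dominates a(Q)^p |Q|, then Hoelder's
    inequality sum_m |F_m|^(1-r) W(F_m)^r <= (|Q| / L)^(1-r) W(Q)^r shows that an
    estimate int_Q u_Q^q <= M |Q|^(1-r) W(Q)^r improves itself to the constant K + M / 2
    when L is large; this is where q < p is used.  Truncating u_Q and adding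
    delta |Q| to W provides some finite M to start with.  Taking for W(Q) the
    supremum of the p-th power sums defining JN_(p,1,s)_alpha over the families in Q,
    with the factors |Q_i|^alpha bounded by that of the ambient cube, gives the
    estimate of each summand of the JN_(p,q,s)_alpha norm by W(Q_i), and superadditivity
    of W sums these up.  The other inequality is Jensen's. *)

From HB Require Import structures.
Require Import Defs.
From mathcomp Require Import all_boot all_order all_algebra.
From mathcomp Require Import all_classical all_reals all_analysis.
From mathcomp Require Import measurable_realfun ring lra zify qpoly.
From mathcomp Require mpoly.
Import (coercions, canonicals) mpoly.

Set Implicit Arguments.
Unset Strict Implicit.
Unset Printing Implicit Defensive.

Import Order.TTheory GRing.Theory Num.Theory.
Import numFieldNormedType.Exports.

Local Open Scope classical_set_scope.
Local Open Scope ring_scope.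

(** * Lebesgue measure of boxes *)

(** No constant may depend on the cube. A polynomial is therefore compared with its mean by explicit
    Lagrange interpolation, a scale invariant bound. It is used twice: for the existence of moment
    projections, and for the distance between P_Q f and P_{F_m} f. The latter is at most a constant
    times a(Q), because maximality of F_m bounds the mean of u_Q over F_m by 2^n L a(Q).

    Absorbing M / 2 requires a finite M. Truncation at a height T and the term delta |Q| provide
    one, but it depends on T and delta. Repeated improvement halves this dependence away and leaves
    2 K, which is free of both, so T may tend to infinity and delta to 0.

    The bound u_Q <= L a(Q) off the F_m is a differentiation theorem along dyadic cells. It is
    derived from approximation in measure: a set where u_Q is too large would be, up to small
    measure, a union of cells of one generation, and on every cell not inside the union of the F_m
    the mean is at most L a(Q). *)

Section lebesgue_boxes.
Context (R : realType).
Local Notation mT := (measurableTypeR R).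
Local Notation I2 b a c d := (Interval (BSide b a) (BSide c d)).

Lemma measurable_borel_euclidean n (A : set (n.-tuple mT)) :
  measurable A -> measurable (A : set (euclidean R n)).
Proof. by move=> mA; exact: caratheodory_measurable_mu_ext. Qed.

Lemma lebesgueE n (A : set (n.-tuple mT)) :
  measurable A -> lebesgue R n A = lebesgue_borel R n A.
Proof. by move=> mA; exact: measurable_mu_extE. Qed.

Lemma measurable_fun_borel_euclidean n d (T : measurableType d)
    (f : n.-tuple mT -> T) :
  measurable_fun setT f -> measurable_fun setT (f : euclidean R n -> T).
Proof.
move=> mf _ Y mY; apply: measurable_borel_euclidean; exact: mf.
Qed.

(** The identity from the completed space to the Borel one is measurable and pushes [lebesgue]
    forward to [lebesgue_borel]. This transfers Tonelli computations on the recursive product to the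
    completed measure. *)
Lemma ge0_integral_lebesgue n (D : set (n.-tuple mT)) (f : n.-tuple mT -> \bar R) :
  measurable D -> measurable_fun [set: n.-tuple mT] f -> (forall x, 0 <= f x)%E ->
  (\int[lebesgue R n]_(x in (D : set (euclidean R n))) f x =
   \int[lebesgue_borel R n]_(x in D) f x)%E.
Proof.
move=> mD mf f0.
have mid : measurable_fun setT (id : euclidean R n -> n.-tuple mT).
  by apply: measurable_fun_borel_euclidean.
transitivity (\int[pushforward (lebesgue R n)
    (id : euclidean R n -> n.-tuple mT)]_(y in D) f y)%E.
  by rewrite (@ge0_integral_pushforward _ _ _ _ _ _ mid)//; exact: measurable_funTS.
apply: eq_measure_integral => A mA AD.
by rewrite /pushforward; exact: lebesgueE.
Qed.

Definition box n (I : 'I_n -> interval R) : set (n.-tuple mT) :=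
  [set x | forall i, tnth x i \in I i].

Lemma measurable_box n (I : 'I_n -> interval R) : measurable (box I).
Proof.
rewrite (_ : box I =
    \bigcap_(i in [set: 'I_n]) ((@tnth n mT ^~ i) @^-1` [set` I i])); last first.
  by apply/seteqP; split=> x /= Hx i; [move=> _; exact: Hx|exact: Hx].
apply: fin_bigcap_measurable => // i _.
rewrite -[X in measurable X]setTI; apply: measurable_tnth => //.
Qed.

Lemma lebesgue_borel_box n (I : 'I_n -> interval R) (l : R) :
  (forall i, lebesgue_measure [set` I i] = l%:E) ->
  lebesgue_borel R n (box I) = (l ^+ n)%:E.
Proof.
elim: n I => [|n IH] I Il /=.
  rewrite /dirac/= indicE expr0 mem_set//.
  by case.
rewrite /product_cons /pushforward.
rewrite (_ : _ @^-1` _ = [set` I ord0] `*` box (fun i => I (lift ord0 i))).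
  rewrite product_measure1E//; last exact: measurable_box.
  rewrite IH//= exprS EFinM; congr (_ * _)%E; exact: Il.
apply/seteqP; split => -[x t] /=.
  move=> H; split => /=; first by have := H ord0; rewrite tnth0.
  by move=> i; have := H (lift ord0 i); rewrite tnthS.
move=> [/= H1 H2] i; case: (unliftP ord0 i) => [j ->|->]; last by rewrite tnth0.
by rewrite tnthS; exact: H2.
Qed.

Lemma lebesgue_measure_side (b c : bool) (a l : R) : 0 < l ->
  lebesgue_measure [set` I2 b a c (a + l)] = l%:E.
Proof.
move=> l0; rewrite lebesgue_measure_itv/= lte_fin ltrDl l0.
by rewrite -EFinD addrAC subrr add0r.
Qed.

Lemma lebesgue_box n (lo hi : 'I_n -> bool) (a : 'I_n -> R) (l : R) : 0 < l ->
  lebesgue R n (box (fun i => I2 (lo i) (a i) (hi i) (a i + l))) = (l ^+ n)%:E.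
Proof.
move=> l0; rewrite lebesgueE; last exact: measurable_box.
by apply: lebesgue_borel_box => i; exact: lebesgue_measure_side.
Qed.

End lebesgue_boxes.

(** * Polynomials are bounded by their means *)

Section poly1.
Context (R : realType).
Local Notation mT := (measurableTypeR R).
Local Notation I2 b a c d := (Interval (BSide b a) (BSide c d)).

(** Each factor |y - t k| / |t i - t k| is at most 2s + 3. The missing factor [k = i] counts as 1,
    also at most 2s + 3, whence the round exponent [s.+1]. *)
Lemma norm_lagrange_le (s : nat) (t : nat -> R) (h y : R) (i : 'I_s.+1) :
  injective t -> 0 < h ->
  (forall j k, j != k -> h <= `|t j - t k|) ->
  (forall j : 'I_s.+1, `|y - t j| <= (2 * s + 3)%:R * h) ->
  `|(tnth (lagrange s.+1 t) i : {poly R}).[y]| <= (2 * s + 3)%:R ^+ s.+1.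
Proof.
move=> tinj h0 sep yt; rewrite lagrangeE// hornerM hornerC !horner_prod.
rewrite normrM normfV mulrC !normr_prod -prodf_div.
rewrite big_mkcond/= -[leRHS]mul1r -[X in _ ^+ X]card_ord -prodr_const mul1r.
apply: ler_prod => j _; case: ifPn => ji; last first.
  by rewrite ler01 /= ler1n; lia.
rewrite !hornerXsubC divr_ge0//= ler_pdivrMr; last first.
  by rewrite (lt_le_trans h0)// sep// eq_sym.
by rewrite (le_trans (yt j))// ler_wpM2l// sep// eq_sym.
Qed.

(** With N = 2s + 3: [s.+1] terms in the interpolation formula, N^(s+1) for each Lagrange basis
    polynomial, and one more N because the interval is N times as long as the pieces on which [p] is
    sampled. *)
Definition lagrange_cst (s : nat) : R := s.+1%:R * (2 * s + 3)%:R ^+ s.+2.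

Lemma lagrange_cst_ge0 s : 0 <= lagrange_cst s.
Proof. by rewrite mulr_ge0// exprn_ge0. Qed.

(* Lagrange interpolation at points [t j] minimizing [|p|] on disjoint intervals of
   length [h]: then [|p.[t j]| * h] is at most the integral of [|p|]. *)
Lemma poly_le_integral (s : nat) (p : {poly R}) (b c : bool) (a l y : R) :
  (size p <= s.+1)%N -> 0 < l -> a <= y <= a + l ->
  ((`|p.[y]| * l)%R%:E <= (lagrange_cst s)%:E *
    \int[lebesgue_measure]_(x in [set` I2 b a c (a + l)%R]) (`|p.[x]|%R)%:E)%E.
Proof.
move=> sp l0 /andP[ay yal].
pose N : R := (2 * s + 3)%:R; pose h := l / N.
have N0 : 0 < N by rewrite ltr0n; lia.
have h0 : 0 < h by rewrite divr_gt0.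
have lE : l = N * h by rewrite /h mulrC divfK// gt_eqF.
(* Of the 2s + 3 pieces of length [h], every second one is kept, starting with the second: the s + 1
   kept pieces are [h] apart and stay away from both ends, so it does not matter which endpoints the
   interval contains. *)
pose u (j : nat) : R := a + (2 * j + 1)%:R * h.
pose v (j : nat) : R := a + (2 * j + 2)%:R * h.
have uv j : u j <= v j by rewrite lerD2l ler_pM2r// ler_nat; lia.
have cp : continuous (fun x => `|p.[x]|).
  move=> x; apply: (@continuous_comp _ _ _ (fun x => p.[x]) (fun x => `|x|)).
    exact: continuous_horner.
  exact: norm_continuous.
have mp A : measurable_fun A (fun x : mT => (`|p.[x]|)%:E).
  apply/measurable_funTS/measurable_EFinP.
  exact: (@continuous_measurable_fun _ _ cp).
have /choice[t tP] : forall j, exists x, x \in `[u j, v j]%R /\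
    forall z, z \in `[u j, v j]%R -> `|p.[x]| <= `|p.[z]|.
  move=> j; have [x xI Hx] := @EVT_min R (fun x => `|p.[x]|) _ _ (uv j)
    (continuous_subspaceT cp).
  by exists x.
have tI j : u j <= t j <= v j by have [] := tP j; rewrite in_itv.
have sep0 j k : (j < k)%N -> h <= t k - t j.
  move=> jk; have /andP[_ tj] := tI j; have /andP[tk _] := tI k.
  rewrite lerBrDr (le_trans _ tk)//.
  rewrite (le_trans (lerD (lexx h) tj))// /v /u addrCA lerD2l.
  rewrite -{1}[h]mul1r -mulrDl ler_pM2r// -[X in X + _]/(1%:R) -natrD ler_nat; lia.
have sep j k : j != k -> h <= `|t j - t k|.
  case: (ltngtP j k) => // jk _; [rewrite distrC|];
    exact: le_trans (sep0 _ _ jk) (ler_norm _).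
have tinj : injective t.
  move=> j k; apply: contra_eq => /sep; apply: contraTneq => ->.
  by rewrite subrr normr0 -ltNge.
have vl (j : 'I_s.+1) : v j < a + l.
  by rewrite lE /v ltrD2l ltr_pM2r// ltr_nat; have := ltn_ord j; lia.
have ul j : a < u j by rewrite ltrDl mulr_gt0// ltr0n; lia.
have yt (j : 'I_s.+1) : `|y - t j| <= N * h.
  have /andP[tu tv] := tI j; rewrite -lE ler_norml; have := vl j; have := ul j.
  by move=> *; apply/andP; split; lra.
set J := (\int[_]_(x in _) _)%E.
have J0 : (0 <= J)%E by apply: integral_ge0 => x _; rewrite lee_fin.
have tJ (j : 'I_s.+1) : ((`|p.[t j]| * h)%R%:E <= J)%E.
  apply: (@le_trans _ _ (\int[lebesgue_measure]_(x in [set` `[u j, v j]%R])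
      (`|p.[x]|%R)%:E)%E).
    rewrite (_ : (_ * _)%:E = \int[lebesgue_measure]_(x in [set` `[u j, v j]%R])
        (`|p.[t j]|%R)%:E)%E.
      apply: ge0_le_integral => //.
      by move=> x /= xI; rewrite lee_fin; exact: (tP j).2.
    rewrite integral_cst//= lebesgue_measure_itv/= lte_fin.
    have vu : v j - u j = h.
      by rewrite /v /u opprD addrACA subrr add0r -mulrBl -natrB; [rewrite subnDl mul1r|lia].
    rewrite ifT; last by rewrite -subr_gt0 vu.
    by rewrite -EFinD vu EFinM.
  apply: ge0_subset_integral => //.
  move=> x /=; rewrite in_itv => /andP[ux xv].
  have ax := lt_le_trans (ul j) ux; have xl := le_lt_trans xv (vl j).
  rewrite itv_boundlr; apply/andP; split.
    by case: b {J J0}; rewrite bnd_simp// ltW.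
  by case: c {J J0}; rewrite bnd_simp// ltW.
have [Joo|Jfin] := eqVneq J +oo%E.
  rewrite Joo gt0_muley ?leey// lte_fin mulr_gt0// exprn_gt0//.
have {Jfin} : J \is a fin_num by rewrite ge0_fin_numE// lt_neqAle Jfin leey.
move: tJ; case: J J0 => // J; rewrite !lee_fin => J0 tJ _.
rewrite {1}(lagrange_gen (ltn0Sn s) tinj sp) horner_sum.
apply: (@le_trans _ _ (\sum_(i < s.+1) N ^+ s.+2 * J)).
  rewrite (le_trans (ler_wpM2r (ltW l0) (ler_norm_sum _ _ _)))//.
  rewrite mulr_suml; apply: ler_sum => i _.
  rewrite hornerM hornerC normrM lE.
  rewrite (_ : _ * (N * h) = N * `|(tnth (lagrange s.+1 t) i : {poly R}).[y]| *
      (`|p.[t i]| * h)); last by ring.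
  have H1 : 0 <= h by exact: ltW.
  have H2 : 0 <= N by exact: ltW.
  have H3 := norm_lagrange_le i tinj h0 sep yt.
  apply: ler_pM; [exact: mulr_ge0|exact: mulr_ge0| |exact: tJ].
  by rewrite exprS ler_pM2l.
by rewrite sumr_const card_ord -[leLHS]mulr_natl mulrA.
Qed.

End poly1.

Section monosum.
Context (R : realType).
Local Notation mT := (measurableTypeR R).
Local Notation I2 b a c d := (Interval (BSide b a) (BSide c d)).

(** Polynomials over an arbitrary index type: freezing the first variable changes coefficients and
    exponents but keeps [K] and [r], so induction on [n] needs no reindexing of multi-indices. *)
Definition monosum n (K : Type) (r : seq K) (c : K -> R) (e : K -> 'I_n -> nat)
    (x : n.-tuple mT) : R :=
  \sum_(k <- r) c k * \prod_(i < n) tnth x i ^+ e k i.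

Lemma measurable_monosum n (K : Type) (r : seq K) c (e : K -> 'I_n -> nat) :
  measurable_fun setT (monosum r c e).
Proof.
apply: measurable_sum => k; apply: measurable_funM => //.
apply: measurable_prod => i _; apply: measurable_funX; exact: measurable_tnth.
Qed.

Lemma monosum_cons n (K : Type) (r : seq K) c (e : K -> 'I_n.+1 -> nat)
    (y : mT) (t : n.-tuple mT) :
  monosum r c e [the n.+1.-tuple mT of y :: t] =
  monosum r (fun k => c k * y ^+ e k ord0) (fun k i => e k (lift ord0 i)) t.
Proof.
apply: eq_bigr => k _; rewrite big_ord_recl mulrA tnth0.
by under eq_bigr do rewrite tnthS.
Qed.

Lemma monosum_poly n (K : Type) (r : seq K) c (e : K -> 'I_n.+1 -> nat) s
    (t : n.-tuple mT) : (forall k i, e k i <= s)%N ->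
  exists2 p : {poly R}, (size p <= s.+1)%N &
    forall y : mT, p.[y] = monosum r c e [the n.+1.-tuple mT of y :: t].
Proof.
move=> es.
exists (\sum_(k <- r) (c k * \prod_(i < n) tnth t i ^+ e k (lift ord0 i)) *: 'X^(e k ord0)).
  elim/big_rec: _ => [|k q _ sq]; first by rewrite size_poly0.
  rewrite (leq_trans (size_polyD _ _))// geq_max sq andbT.
  by rewrite (leq_trans (size_scale_leq _ _))// size_polyXn ltnS.
move=> y; rewrite horner_sum; apply: eq_bigr => k _.
rewrite hornerZ hornerXn big_ord_recl tnth0 -mulrA; congr (_ * _).
rewrite mulrC; congr (_ * _).
by apply: eq_bigr => i _; rewrite tnthS.
Qed.

(** Induction on the number of variables: the one-variable bound in the first coordinate, with the
    others frozen at [x], then the induction hypothesis on each slice under the integral, and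
    Tonelli. Exponents are bounded variable by variable because this condition passes to slices. *)
Lemma monosum_le_integral n (K : Type) (r : seq K) c (e : K -> 'I_n -> nat) s
    (lo hi : 'I_n -> bool) (a : 'I_n -> R) (l : R) (x : n.-tuple mT) :
  (forall k i, e k i <= s)%N -> 0 < l ->
  (forall i, a i <= tnth x i <= a i + l) ->
  ((`|monosum r c e x| * l ^+ n)%R%:E <= (lagrange_cst R s ^+ n)%R%:E *
   \int[lebesgue_borel R n]_(y in box (fun i => I2 (lo i) (a i) (hi i) (a i + l)%R))
     `|monosum r c e y|%R%:E)%E.
Proof.
move=> + l0; elim: n c e lo hi a x => [|n IH] c e lo hi a x es xa.
  rewrite !expr0 mulr1 mul1e integral_dirac//.
  - rewrite diracE mem_set ?mul1e; last by case.
    by rewrite (tuple0 x) lexx.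
  - exact: measurable_box.
  - apply/measurable_funTS/measurable_EFinP/measurableT_comp => //.
    exact: measurable_monosum.
case: (tupleP x) xa => y x' xa.
set Q := box _; set C := lagrange_cst R s.
have C0 : 0 <= C by exact: lagrange_cst_ge0.
have mQ : measurable Q by exact: measurable_box.
have mF : measurable_fun [set: n.+1.-tuple mT] (fun y => (`|monosum r c e y|%R)%:E).
  apply/measurable_EFinP/measurableT_comp => //; exact: measurable_monosum.
pose Q' := box (fun i => I2 (lo (lift ord0 i)) (a (lift ord0 i))
  (hi (lift ord0 i)) (a (lift ord0 i) + l)%R).
(* Extension by zero to the whole product, so that Tonelli applies without cutting [Q] into slices
   beforehand. *)
pose G := (fun z : mT * n.-tuple mT =>
  (`|monosum r c e (tuple_of_pair z)|%R)%:E) \_ (@tuple_of_pair _ mT n @^-1` Q).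
have mtp : measurable_fun setT (@tuple_of_pair _ mT n) by exact: measurable_cons.
have mtpQ : measurable (@tuple_of_pair _ mT n @^-1` Q).
  by rewrite -[X in measurable X]setTI; exact: mtp.
have G0 z : (0 <= G z)%E by apply: erestrict_ge0 => w _; rewrite lee_fin.
have mG : measurable_fun setT G.
  apply/(measurable_restrictT _ mtpQ); apply: measurable_funTS.
  exact: (measurableT_comp mF mtp).
have GE z : z \in [set` I2 (lo ord0) (a ord0) (hi ord0) (a ord0 + l)] ->
    (\int[lebesgue_borel R n]_t G (z, t) = \int[lebesgue_borel R n]_(t in Q')
      `|monosum r c e [the n.+1.-tuple mT of z :: t]|%R%:E)%E.
  rewrite inE/= => zI; rewrite [RHS]integral_mkcond; apply: eq_integral => t _.
  rewrite /G /patch; congr (if _ then _ else _); apply/idP/idP; rewrite !inE.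
    by move=> H i; have := H (lift ord0 i); rewrite /= tnthS.
  move=> H i; case: (unliftP ord0 i) => [j ->|->]; last by rewrite tnth0.
  by rewrite /= tnthS; exact: H.
have -> : (\int[lebesgue_borel R n.+1]_(y in Q) `|monosum r c e y|%R%:E =
           \int[lebesgue_measure]_z \int[lebesgue_borel R n]_t G (z, t))%E.
  transitivity (\int[lebesgue_measure \x lebesgue_borel R n]_z G z)%E.
    rewrite -integral_mkcond; apply: (ge0_integral_pushforward mtp) => //.
    exact: measurable_funTS.
  by rewrite fubini_tonelli1.
have [p sp pE] := monosum_poly r c x' es.
have ya : a ord0 <= y <= a ord0 + l by have := xa ord0; rewrite tnth0.
have := @poly_le_integral R s p (lo ord0) (hi ord0) (a ord0) l y sp l0 ya.
rewrite -/C => H1.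
rewrite exprS mulrA -pE mulrC EFinM.
apply: (@le_trans _ _ ((l ^+ n)%:E * (C%:E *
  \int[lebesgue_measure]_(z in [set` I2 (lo ord0) (a ord0) (hi ord0) (a ord0 + l)%R])
    `|p.[z]|%R%:E))%E).
  by apply: (@lee_wpmul2l R (l ^+ n)%:E); rewrite ?lee_fin ?exprn_ge0 ?(ltW l0).
rewrite muleCA exprS (EFinM C) -muleA; apply: (@lee_wpmul2l R C%:E); first by rewrite lee_fin.
have mp A : measurable_fun A (fun x : mT => (`|p.[x]|%R)%:E).
  apply/measurable_funTS/measurable_EFinP/measurableT_comp => //.
  by apply: continuous_measurable_fun; exact: continuous_horner.
have ln0 : 0 <= l ^+ n by rewrite exprn_ge0// ltW.
have mGint : measurable_fun setT (fun z => \int[lebesgue_borel R n]_t G (z, t))%E.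
  exact: measurable_fun_fubini_tonelli_F.
rewrite -ge0_integralZl//.
rewrite -[leRHS]ge0_integralZl//; last 2 first.
- by move=> z _; exact: integral_ge0.
- by rewrite lee_fin exprn_ge0.
apply: (@le_trans _ _ (\int[lebesgue_measure]_(z in
    [set` I2 (lo ord0) (a ord0) (hi ord0) (a ord0 + l)%R])
    ((C ^+ n)%:E * \int[lebesgue_borel R n]_t G (z, t)))%E).
  apply: ge0_le_integral => //.
  - by move=> z _; rewrite mule_ge0// lee_fin.
  - exact: measurable_funeM.
  - by apply/measurable_funTS/measurable_funeM.
  move=> z zI; rewrite GE ?inE//.
  rewrite pE monosum_cons.
  under eq_integral do rewrite monosum_cons.
  rewrite -EFinM mulrC; apply: IH => //.
  by move=> i; have := xa (lift ord0 i); rewrite tnthS.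
apply: ge0_subset_integral => //.
- exact: measurable_funeM.
- move=> z _; apply: mule_ge0; first by rewrite lee_fin exprn_ge0.
  exact: integral_ge0.
Qed.

End monosum.

(** * Moment projections *)

Section finite_measure_Rintegral.
Context d (T : measurableType d) (R : realType).
Variable mu : {measure set T -> \bar R}.
Variable D : set T.
Hypothesis mD : measurable D.

Lemma le_bounded_integrable (f : T -> R) (M : R) : (mu D < +oo)%E ->
  measurable_fun D f -> (forall x, D x -> `|f x| <= M) ->
  mu.-integrable D (EFin \o f).
Proof.
move=> Dfin mf fM; apply: measurable_bounded_integrable => //.
by exists M; split; [exact: num_real|move=> y My x /fM fx; exact: le_trans fx (ltW My)].
Qed.

Lemma integrableM_le_bounded (f h : T -> R) (M : R) :
  mu.-integrable D (EFin \o f) ->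
  measurable_fun D h -> (forall x, D x -> `|h x| <= M) ->
  mu.-integrable D (EFin \o (fun x => f x * h x)).
Proof.
move=> fi mh hM; apply: (integrableMl mD fi mh).
by exists M; split; [exact: num_real|move=> y My x /hM hx; exact: le_trans hx (ltW My)].
Qed.

Lemma integrable_Rsum (I : Type) (r : seq I) (f : I -> T -> R) :
  (forall i, mu.-integrable D (EFin \o f i)) ->
  mu.-integrable D (EFin \o (fun x => \sum_(i <- r) f i x)).
Proof.
move=> fi; rewrite (_ : EFin \o _ = (fun x => \sum_(i <- r) (f i x)%:E)%E).
  apply: (@integrable_sum _ _ _ mu D mD _ r xpredT (fun i x => (f i x)%:E)) => i _.
  exact: fi.
by apply/funext => x /=; rewrite sumEFin.
Qed.

Lemma Rintegral_sum (I : Type) (r : seq I) (f : I -> T -> R) :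
  (forall i, mu.-integrable D (EFin \o f i)) ->
  \int[mu]_(x in D) (\sum_(i <- r) f i x) = \sum_(i <- r) \int[mu]_(x in D) f i x.
Proof.
move=> fi; elim: r => [|i r IH].
  by under eq_Rintegral do rewrite big_nil; rewrite Rintegral_cst// mul0r big_nil.
under eq_Rintegral do rewrite big_cons.
by rewrite RintegralD// ?IH ?big_cons//; exact: integrable_Rsum.
Qed.

(** Cauchy-Schwarz against the constant 1, obtained by expanding the nonnegative integral of the
    square of |w| minus its mean. *)
Lemma sqr_Rintegral_le (w : T -> R) : 0 < fine (mu D) -> (mu D < +oo)%E ->
  mu.-integrable D (EFin \o w) ->
  mu.-integrable D (EFin \o (fun x => w x ^+ 2)) ->
  (\int[mu]_(x in D) `|w x|) ^+ 2 <= fine (mu D) * \int[mu]_(x in D) (w x ^+ 2).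
Proof.
move=> V0 Vfin wi w2i; set V := fine _; set I1 := Rintegral _ _ _.
have nwi : mu.-integrable D (EFin \o (Num.norm \o w)) by exact: integrable_norm.
have ci c : mu.-integrable D (EFin \o (fun=> c)).
  by apply: (@le_bounded_integrable _ `|c|).
have mwi c : mu.-integrable D (EFin \o (fun x => c * `|w x|)).
  by apply: (integrableZl mD c nwi).
have : 0 <= \int[mu]_(x in D) (w x ^+ 2 - ((2 * (I1 / V)) * `|w x| - (I1 / V) ^+ 2)).
  apply: Rintegral_ge0 => x _.
  rewrite (_ : _ - _ = (`|w x| - I1 / V) ^+ 2) ?sqr_ge0//.
  by rewrite -(real_normK (num_real (w x))); ring.
rewrite RintegralB//; last first.
  by apply: (integrableB mD (mwi _) (ci _)).
rewrite RintegralB// RintegralZl// Rintegral_cst// -/I1 -/V subr_ge0.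
rewrite -(ler_pM2l V0); apply: le_trans.
by rewrite -/V le_eqVlt; apply/orP; left; apply/eqP; field; rewrite gt_eqF.
Qed.

(* The right-hand side of the normal equations annihilates the kernel of the Gram
   matrix, so the equations are solvable even if the [phi i] are dependent. *)
Lemma orthogonal_projection_exists (k : nat) (phi : 'I_k -> T -> R) (f : T -> R) :
  (forall i j, mu.-integrable D (EFin \o (fun x => phi i x * phi j x))) ->
  (forall i, mu.-integrable D (EFin \o (fun x => f x * phi i x))) ->
  (forall c : 'I_k -> R,
     \int[mu]_(x in D) ((\sum_i c i * phi i x) ^+ 2) = 0 ->
     forall x, D x -> \sum_i c i * phi i x = 0) ->
  exists c : 'I_k -> R, forall j,
    \int[mu]_(x in D) ((f x - \sum_i c i * phi i x) * phi j x) = 0.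
Proof.
move=> pi fi H.
pose G := \matrix_(i < k, j < k) \int[mu]_(x in D) (phi i x * phi j x).
pose b := \row_(j < k) \int[mu]_(x in D) (f x * phi j x).
have ppi c i j : mu.-integrable D (EFin \o (fun x => c * (phi i x * phi j x))).
  exact: (integrableZl mD c (pi i j)).
have fpi c i : mu.-integrable D (EFin \o (fun x => c * (f x * phi i x))).
  exact: (integrableZl mD c (fi i)).
have combi (c : 'I_k -> R) j :
    mu.-integrable D (EFin \o (fun x => (\sum_i c i * phi i x) * phi j x)).
  rewrite (_ : (fun x => _) = (fun x => \sum_i c i * (phi i x * phi j x))).
    by apply: integrable_Rsum => i.
  by apply/funext => x; rewrite mulr_suml; under eq_bigr do rewrite -mulrA.
have combE (c : 'I_k -> R) j :
    \int[mu]_(x in D) ((\sum_i c i * phi i x) * phi j x) = \sum_i c i * G i j.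
  transitivity (\int[mu]_(x in D) (\sum_i c i * (phi i x * phi j x))).
    by apply: eq_Rintegral => x _; rewrite mulr_suml; under eq_bigr do rewrite -mulrA.
  rewrite Rintegral_sum//; apply: eq_bigr => i _.
  by rewrite RintegralZl// mxE.
(* It suffices that [b] annihilates each column [v] of [cokermx G]. As [G v = 0], the combination of
   the [phi i] with coefficients [v] has vanishing square integral, hence is 0 on [D], and so is its
   integral against [f], which is [b v]. *)
have : (b <= G)%MS.
  rewrite submxE; apply/eqP/rowP => j; rewrite !mxE.
  pose v (i : 'I_k) := cokermx G i j.
  have Gv i : \sum_l v l * G l i = 0.
    have := mulmx_coker G => /matrixP/(_ i j); rewrite !mxE => GC; rewrite -[RHS]GC.
    apply: eq_bigr => l _; rewrite mulrC; congr (_ * _).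
    by rewrite !mxE; apply: eq_Rintegral => x _; rewrite mulrC.
  have w0 : forall x, D x -> \sum_i v i * phi i x = 0.
    apply: H.
    transitivity (\int[mu]_(x in D) \sum_j v j * ((\sum_i v i * phi i x) * phi j x)).
      apply: eq_Rintegral => x _; rewrite expr2 mulr_sumr.
      by apply: eq_bigr => i _; rewrite mulrCA.
    rewrite Rintegral_sum.
      rewrite big1// => i _; rewrite RintegralZl// combE Gv mulr0//.
    by move=> i; exact: (integrableZl mD (v i) (combi v i)).
  transitivity (\int[mu]_(x in D) (\sum_i v i * (f x * phi i x))).
    rewrite Rintegral_sum//; apply: eq_bigr => i _.
    by rewrite RintegralZl// [b _ _]mxE mulrC.
  transitivity (\int[mu]_(x in D) (0 : R)); last by rewrite Rintegral_cst// mul0r.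
  apply: eq_Rintegral => x; rewrite inE => Dx.
  rewrite -[RHS](mulr0 (f x)) -[in RHS](w0 x Dx) mulr_sumr.
  by apply: eq_bigr => i _; rewrite mulrCA.
move=> /submxP[c bE]; exists (fun i => c 0 i) => j.
under eq_Rintegral do rewrite mulrBl.
rewrite RintegralB// combE; apply/eqP; rewrite subr_eq0; apply/eqP.
by have /rowP/(_ j) := bE; rewrite !mxE.
Qed.

End finite_measure_Rintegral.

Section cubes.
Context (R : realType) (n : nat).
Local Notation E := (euclidean R n).
Local Notation mu := (lebesgue R n).
Local Notation ev P x := (mpoly.meval (coordinate x) P).
Local Notation I2 b a c d := (Interval (BSide b a) (BSide c d)).
Implicit Types (Q : set E) (f : E -> R) (P : mpoly.mpoly n R).

Lemma cube_measurable Q : is_cube Q -> measurable Q.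
Proof.
move=> [a [l [lo [hi [l0 ->]]]]]; apply: measurable_borel_euclidean.
exact: measurable_box.
Qed.

Lemma cube_measure Q : is_cube Q -> mu Q = (volume Q)%:E /\ 0 < volume Q.
Proof.
move=> [a [l [lo [hi [l0 ->]]]]].
have muQ := lebesgue_box lo hi a l0.
by rewrite /volume muQ/= exprn_gt0.
Qed.

Lemma cube_bounded Q : is_cube Q -> euclidean_bounded Q.
Proof.
move=> [a [l [lo [hi [l0 ->]]]]].
exists (\sum_i (`|a i| + `|a i + l|)) => x xQ i.
have := xQ i; rewrite itv_boundlr => /andP[lx xu].
have {lx}lx : a i <= coordinate x i by case: (lo i) lx; rewrite bnd_simp// => /ltW.
have {xu}xu : coordinate x i <= a i + l by case: (hi i) xu; rewrite bnd_simp// => /ltW.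
rewrite (bigD1 i)//=.
apply: (@le_trans _ _ (`|a i| + `|a i + l|)); last by rewrite lerDl sumr_ge0.
rewrite ler_norml; have := ler_norm (- a i); have := ler_norm (a i + l).
have := normr_ge0 (a i); have := normr_ge0 (a i + l); rewrite normrN => *.
by apply/andP; split; lra.
Qed.

Lemma meval_monosum P x : ev P x = monosum (mpoly.msupp P)
  (fun m => mpoly.mcoeff m P) (fun m i => m i) x.
Proof. by rewrite mpoly.mevalE. Qed.

Lemma measurable_meval P : measurable_fun setT (fun x : E => ev P x).
Proof.
rewrite (_ : (fun x => _) = monosum (mpoly.msupp P)
  (fun m => mpoly.mcoeff m P) (fun m i => m i)).
  by apply: measurable_fun_borel_euclidean; exact: measurable_monosum.
by apply/funext => x; exact: meval_monosum.
Qed.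

Lemma meval_bounded P Q : is_cube Q ->
  exists M, forall x, Q x -> `|ev P x| <= M.
Proof.
move=> /cube_bounded[M QM].
exists (\sum_(m <- mpoly.msupp P) `|mpoly.mcoeff m P| * \prod_(i < n) M ^+ m i) => x Qx.
rewrite mpoly.mevalE (le_trans (ler_norm_sum _ _ _))//; apply: ler_sum => m _.
rewrite normrM ler_wpM2l// normr_prod; apply: ler_prod => i _.
by rewrite normr_ge0 normrX lerXn2r ?nnegrE//; [exact: le_trans (QM _ Qx i)|exact: QM].
Qed.

Lemma integrable_meval P Q : is_cube Q -> mu.-integrable Q (EFin \o (fun x => ev P x)).
Proof.
move=> cQ; have [M PM] := meval_bounded P cQ.
apply: (le_bounded_integrable (cube_measurable cQ) _ _ PM).
  by rewrite (cube_measure cQ).1 ltry.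
by apply: measurable_funTS; exact: measurable_meval.
Qed.

Lemma integrableM_meval f P Q : is_cube Q -> mu.-integrable Q (EFin \o f) ->
  mu.-integrable Q (EFin \o (fun x => f x * ev P x)).
Proof.
move=> cQ fi; have [M PM] := meval_bounded P cQ.
apply: (integrableM_le_bounded (cube_measurable cQ) fi _ PM).
by apply: measurable_funTS; exact: measurable_meval.
Qed.

Lemma integrableB_meval f P Q : is_cube Q -> mu.-integrable Q (EFin \o f) ->
  mu.-integrable Q (EFin \o (fun x => f x - ev P x)).
Proof.
by move=> cQ fi; apply: (integrableB (cube_measurable cQ) fi (integrable_meval P cQ)).
Qed.

Definition meval_cst (s : nat) : R := lagrange_cst R s ^+ n.

Lemma meval_cst_ge0 s : 0 <= meval_cst s.
Proof. by rewrite exprn_ge0// lagrange_cst_ge0. Qed.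

Lemma mnm_le_mdeg (m : mpoly.multinom n) i : (m i <= mpoly.mdeg m)%N.
Proof. by rewrite mpoly.mdegE (bigD1 i)//= leq_addr. Qed.

(** The constant depends on [n] and [s] alone, not on the cube, so the bound may be used at all
    dyadic scales at once. *)
Lemma meval_le_Rintegral s P Q x : (mpoly.msize P <= s.+1)%N ->
  is_cube Q -> Q x ->
  `|ev P x| * volume Q <= meval_cst s * \int[mu]_(y in Q) `|ev P y|.
Proof.
move=> Ps cQ; have [a [l [lo [hi [l0 QE]]]]] := cQ => Qx.
(* [monosum_le_integral] bounds the exponents of every index, also outside the support of [P]; on
   the support the cap at [s] changes nothing. *)
pose e (m : mpoly.multinom n) i := minn (m i) s.
pose h := monosum (mpoly.msupp P) (fun m => mpoly.mcoeff m P) e.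
have evE y : ev P y = h y.
  rewrite mpoly.mevalE; apply: eq_big_seq => m mP; congr (_ * _).
  apply: eq_bigr => i _; rewrite /e (minn_idPl _)//.
  have := mpoly.msize_mdeg_lt mP; have := mnm_le_mdeg m i; lia.
have xa i : a i <= coordinate x i <= a i + l.
  move: Qx; rewrite QE => /(_ i); rewrite itv_boundlr => /andP[lx xu].
  by apply/andP; split; [case: (lo i) lx|case: (hi i) xu]; rewrite bnd_simp// => /ltW.
have vE : volume Q = l ^+ n by rewrite /volume QE lebesgue_box.
have := @monosum_le_integral R n _ (mpoly.msupp P) (fun m => mpoly.mcoeff m P) e s
  lo hi a l x (fun m i => geq_minr _ _) l0 xa.
rewrite -ge0_integral_lebesgue//; last 2 first.
- exact: measurable_box.
- by apply/measurable_EFinP/measurableT_comp => //; exact: measurable_monosum.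
rewrite -/h -evE -vE.
under eq_integral do rewrite -evE.
have -> : box (fun i => I2 (lo i) (a i) (hi i) (a i + l)) = Q by rewrite QE.
rewrite -[(\int[_]_(_ in _) _)%E]fineK; first by rewrite -EFinM lee_fin.
apply: integrable_fin_num; first exact: cube_measurable.
by have := integrable_norm (integrable_meval P cQ).
Qed.

Lemma moment_orthogonal s f P w Q : is_cube Q -> mu.-integrable Q (EFin \o f) ->
  is_moment_projection s f Q P -> (mpoly.msize w <= s.+1)%N ->
  \int[mu]_(x in Q) ((f x - ev P x) * ev w x) = 0.
Proof.
move=> cQ fi [_ HP] ws; have mQ := cube_measurable cQ.
pose m_ (m : mpoly.multinom n) x : R := \prod_(i < n) coordinate x i ^+ m i.
have mE m x : m_ m x = ev (mpoly.mpolyX R m) x by rewrite mpoly.mevalX.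
have gi := integrableB_meval P cQ fi.
have gmi m : mu.-integrable Q (EFin \o (fun x => (f x - ev P x) * m_ m x)).
  rewrite (_ : m_ m = fun x => ev (mpoly.mpolyX R m) x); last exact/funext.
  exact: integrableM_meval.
transitivity (\int[mu]_(x in Q) \sum_(m <- mpoly.msupp w)
    mpoly.mcoeff m w * ((f x - ev P x) * m_ m x)).
  apply: eq_Rintegral => x _; rewrite mpoly.mevalE mulr_sumr.
  by apply: eq_bigr => m _; rewrite mulrCA.
rewrite Rintegral_sum//; last by move=> m; exact: (integrableZl mQ _ (gmi m)).
rewrite big_seq big1// => m mw; rewrite RintegralZl// {1}/Rintegral HP ?mulr0//.
have := mpoly.msize_mdeg_lt mw; lia.
Qed.

(** Cauchy-Schwarz makes the mean of |w| vanish, and the bound by the mean turns this into vanishing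
    at every point of [Q]. This is the condition that [orthogonal_projection_exists] puts on the
    monomials. *)
Lemma meval_sqr_Rintegral_eq0 s w Q : is_cube Q -> (mpoly.msize w <= s.+1)%N ->
  \int[mu]_(x in Q) (ev w x ^+ 2) = 0 -> forall x, Q x -> ev w x = 0.
Proof.
move=> cQ ws w0 x Qx; have [muQ V0] := cube_measure cQ.
have wi := integrable_meval w cQ.
have w2i : mu.-integrable Q (EFin \o (fun x => ev w x ^+ 2)).
  exact: (integrableM_meval w cQ wi).
have := sqr_Rintegral_le (cube_measurable cQ) V0 _ wi w2i.
rewrite muQ ltry w0 mulr0 => /(_ isT).
rewrite real_exprn_even_le0 ?num_real//= => /eqP I0.
have := meval_le_Rintegral ws cQ Qx; rewrite I0 mulr0.
by rewrite pmulr_lle0// normr_le0 => /eqP.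
Qed.

Lemma moment_projection_exists s f Q : is_cube Q -> mu.-integrable Q (EFin \o f) ->
  exists P, is_moment_projection s f Q P.
Proof.
move=> cQ fi; have mQ := cube_measurable cQ.
(* The finite type of multi-indices of degree strictly below [s.+1]. *)
pose K := mpoly.bmultinom n s.+1.
pose X (i : 'I_#|{: K}|) : mpoly.mpoly n R := mpoly.mpolyX R (enum_val i : K).
pose phi i (x : E) : R := ev (X i) x.
have combE (c : 'I_#|{: K}| -> R) x :
    \sum_i c i * phi i x = ev (\sum_i c i *: X i) x.
  by rewrite raddf_sum; apply: eq_bigr => i _; rewrite /= mpoly.mevalZ.
have combs (c : 'I_#|{: K}| -> R) : (mpoly.msize (\sum_i c i *: X i) <= s.+1)%N.
  apply: (leq_trans (mpoly.mmeasure_sum _ _ _ _)); apply/bigmax_leqP => i _.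
  rewrite (leq_trans (mpoly.msizeZ_le _ _))// mpoly.msizeX ltnS -ltnS.
  exact: mpoly.bmdeg.
have [|||c Hc] := @orthogonal_projection_exists _ E R mu Q mQ #|{: K}| phi f.
- move=> i j; apply: integrableM_meval => //; exact: integrable_meval.
- by move=> i; exact: integrableM_meval.
- move=> c c0 x Qx; rewrite combE; apply: meval_sqr_Rintegral_eq0 cQ (combs c) _ _ Qx.
  by under eq_Rintegral do rewrite -combE.
exists (\sum_i c i *: X i); split => // g gs.
have gs' : (mpoly.mdeg g < s.+1)%N by [].
have gi := integrableB_meval (\sum_i c i *: X i) cQ fi.
rewrite -[LHS]fineK; last first.
  apply: (integrable_fin_num mQ).
  rewrite (_ : (fun x => _) = EFin \o
      (fun x => (f x - ev (\sum_i c i *: X i) x) * ev (mpoly.mpolyX R g) x)).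
    exact: integrableM_meval.
  by apply/funext => x; rewrite /= mpoly.mevalX.
congr EFin.
rewrite -[RHS](Hc (enum_rank (mpoly.BMultinom gs'))).
apply: eq_Rintegral => x _; rewrite combE /phi /X enum_rankK/=.
by rewrite mpoly.mevalX.
Qed.

Lemma moment_projectionP s f Q : is_cube Q -> mu.-integrable Q (EFin \o f) ->
  is_moment_projection s f Q (moment_projection s f Q).
Proof.
by move=> cQ fi; apply: (xgetPex 0); exact: moment_projection_exists.
Qed.

(* For [w = P - T], orthogonality gives [int w^2 = int (f - T) w], and [|w|] is bounded
   by its mean. *)
Lemma moment_projection_sub_le s f P T Q x : is_cube Q ->
  mu.-integrable Q (EFin \o f) ->
  is_moment_projection s f Q P -> (mpoly.msize T <= s.+1)%N -> Q x ->
  `|ev P x - ev T x| * volume Q <=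
    meval_cst s ^+ 2 * \int[mu]_(y in Q) `|f y - ev T y|.
Proof.
move=> cQ fi HP Ts Qx; have [muQ V0] := cube_measure cQ.
have mQ := cube_measurable cQ.
pose w := P - T; have wE y : ev w y = ev P y - ev T y by rewrite mpoly.mevalB.
have ws : (mpoly.msize w <= s.+1)%N.
  rewrite (leq_trans (mpoly.mmeasureD_le _ _ _))// geq_max HP.1/=.
  by rewrite mpoly.mmeasureN.
have wi := integrable_meval w cQ.
have w2i : mu.-integrable Q (EFin \o (fun x => ev w x ^+ 2)).
  exact: (integrableM_meval w cQ wi).
have := sqr_Rintegral_le mQ V0 _ wi w2i; rewrite muQ ltry/= -/(volume Q) => /(_ isT).
set I1 := \int[mu]_(_ in _) `|_| => CS.
set C := meval_cst s; set J := Rintegral _ _ _.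
have C0 : 0 <= C := meval_cst_ge0 s.
have wx y : Q y -> `|ev w y| * volume Q <= C * I1 by exact: meval_le_Rintegral.
have I10 : 0 <= I1 by exact: Rintegral_ge0.
have J0 : 0 <= J by exact: Rintegral_ge0.
have fTi := integrableB_meval T cQ fi.
have w2E : \int[mu]_(x in Q) (ev w x ^+ 2) = \int[mu]_(x in Q) ((f x - ev T x) * ev w x).
  apply/eqP; rewrite eq_sym -subr_eq0 -RintegralB//; last exact: integrableM_meval.
  rewrite -[eqbRHS](moment_orthogonal cQ fi HP ws); apply/eqP.
  by apply: eq_Rintegral => y _; rewrite wE; ring.
have w2J : \int[mu]_(x in Q) (ev w x ^+ 2) <= (C * I1 / volume Q) * J.
  rewrite w2E /J -RintegralZl//; last by have := integrable_norm fTi.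
  apply: le_Rintegral => //; first exact: integrableM_meval.
    by have ni := integrable_norm fTi; apply: (integrableZl mQ (C * I1 / volume Q) ni).
  move=> y Qy; rewrite (le_trans (ler_norm _))// normrM mulrC ler_wpM2r//.
  by rewrite ler_pdivlMr// wx.
have {}CS : I1 ^+ 2 <= I1 * (C * J).
  rewrite (le_trans CS)// (le_trans (ler_wpM2l (ltW V0) w2J))//.
  rewrite le_eqVlt; apply/orP; left; apply/eqP; field; rewrite gt_eqF//.
(* One factor [I1] cancels. This is the first factor [C] of the result; the second comes from
   bounding |w| at [x] by its mean. *)
have I1J : I1 <= C * J.
  have [->|I1n0] := eqVneq I1 0; first exact: mulr_ge0.
  by rewrite -(@ler_pM2l _ I1) ?lt_def ?I1n0// -expr2.
by rewrite -wE (le_trans (wx x Qx))// expr2 -mulrA ler_wpM2l.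
Qed.

End cubes.

(** * Dyadic grids *)

Section algebra_approximation.
Context d (T : measurableType d) (R : realType) (mu : {measure set T -> \bar R}).
Variables (A0 : set T) (alg : set (set T)).
Hypotheses (mA0 : measurable A0) (A0fin : (mu A0 < +oo)%E).
Hypotheses (alg_measurable : alg `<=` measurable) (alg0 : alg set0)
  (algC : forall D, alg D -> alg (~` D))
  (algU : forall D1 D2, alg D1 -> alg D2 -> alg (D1 `|` D2)).

(** The closure of [alg] for the pseudometric given by the measure, within [A0], of the symmetric
    difference, written [+] between backquotes. It is shown to be a sigma-algebra. *)
Definition approximable : set (set T) := [set B | measurable B /\
  forall e : R, 0 < e -> exists2 D, alg D & (mu (A0 `&` (B `+` D)) < e%:E)%E].

Let mA0Y B D : measurable B -> measurable D -> measurable (A0 `&` (B `+` D)).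
Proof.
by move=> mB mD; apply: measurableI => //; apply: measurableU; exact: measurableD.
Qed.

Lemma approximableC B : approximable B -> approximable (~` B).
Proof.
move=> [mB HB]; split; first exact: measurableC.
move=> e e0; have [D aD HD] := HB e e0; exists (~` D); first exact: algC.
rewrite (_ : ~` B `+` ~` D = B `+` D)//.
by apply/seteqP; split => x /=; have := EM (B x); have := EM (D x); tauto.
Qed.

Lemma approximableU B1 B2 : approximable B1 -> approximable B2 ->
  approximable (B1 `|` B2).
Proof.
move=> [mB1 HB1] [mB2 HB2]; split; first exact: measurableU.
move=> e e0; have e20 : 0 < e / 2 by rewrite divr_gt0.
have [D1 aD1 HD1] := HB1 _ e20; have [D2 aD2 HD2] := HB2 _ e20.
exists (D1 `|` D2); first exact: algU.
have mD1 := alg_measurable aD1; have mD2 := alg_measurable aD2.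
apply: (@le_lt_trans _ _ (mu ((A0 `&` (B1 `+` D1)) `|` (A0 `&` (B2 `+` D2))))).
  apply: le_measure; rewrite ?inE.
  - by apply: mA0Y; exact: measurableU.
  - by apply: measurableU; exact: mA0Y.
  - by move=> x /=; tauto.
rewrite (le_lt_trans (measureU2 _ _ _))//; try exact: mA0Y.
by rewrite [e]splitr EFinD lteD.
Qed.

(** A partial union [U m] misses less than e / 2 of the whole inside [A0], by continuity from below
    and finiteness of [mu A0]; being a finite union, [U m] is itself approximable up to e / 2. *)
Lemma approximable_bigcup (B : (set T)^nat) : (forall i, approximable (B i)) ->
  approximable (\bigcup_i B i).
Proof.
move=> HB; have mB i : measurable (B i) by have [] := HB i.
have mUB : measurable (\bigcup_i B i) by exact: bigcupT_measurable.
split=> // e e0; have e20 : 0 < e / 2 by rewrite divr_gt0.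
pose U m := \big[setU/set0]_(i < m) B i.
have HU m : approximable (U m).
  rewrite /U; elim/big_ind: _ => //; last exact: approximableU.
  split=> // e' e'0; exists set0 => //; rewrite (_ : _ `&` _ = set0) ?measure0//.
  by apply/seteqP; split => x //=; tauto.
have mU m : measurable (U m) by have [] := HU m.
have ndU : nondecreasing_seq (fun m => A0 `&` U m).
  by move=> i j ij; apply/subsetPset; apply: setIS; apply: subset_bigsetU.
have cvU : mu (A0 `&` U m) @[m --> \oo] --> mu (A0 `&` \bigcup_i B i).
  have UE : A0 `&` \bigcup_i B i = \bigcup_m (A0 `&` U m).
    rewrite -setI_bigcupr; congr (_ `&` _); apply/seteqP; split.
      move=> x [i _ Bx]; exists i.+1 => //; rewrite /U big_ord_recr/=; by right.
    move=> x [m _]; rewrite /U -bigcup_mkord => -[i _ Bx]; by exists i.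
  rewrite UE; apply: nondecreasing_cvg_mu => //.
  - by move=> m; exact: measurableI.
  - by apply: bigcupT_measurable => m; exact: measurableI.
have finI C : measurable C -> (mu (A0 `&` C) < +oo)%E.
  move=> mC; rewrite (le_lt_trans _ A0fin)//.
  by apply: le_measure => //; rewrite ?inE//; exact: measurableI.
have finIn C : measurable C -> mu (A0 `&` C) \is a fin_num.
  by move=> mC; rewrite ge0_fin_numE//; exact: finI.
have LE m : (mu (A0 `&` \bigcup_i B i) =
    mu (A0 `&` U m) + mu (A0 `&` (\bigcup_i B i `\` U m)))%E.
  rewrite -measureU.
  - congr (mu _); apply/seteqP; split => x /=; have := EM (U m x).
      tauto.
    move=> _ [|[? []//]]; rewrite /U -bigcup_mkord => -[? [i _ Bi]].
    by split => //; exists i.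
  - exact: measurableI.
  - by apply: measurableI => //; exact: measurableD.
  - by apply/seteqP; split => x //=; tauto.
(* If all remainders had measure at least e / 2, the limit of the measures of the [U m] would stay e
   / 2 below itself, which is absurd for a finite number. *)
have [m Hm] : exists m, (mu (A0 `&` (\bigcup_i B i `\` U m)) < (e / 2)%:E)%E.
  apply/not_existsP => H.
  have : (mu (A0 `&` \bigcup_i B i) <= mu (A0 `&` \bigcup_i B i) - (e / 2)%:E)%E.
    rewrite -{1}(cvg_lim _ cvU)//; apply: lime_le.
      by apply/cvg_ex; eexists; exact: cvU.
    apply: nearW => m; rewrite leeBrDr// (LE m) leeD2l//.
    by rewrite leNgt; apply/negP; exact: H.
  have := finIn _ mUB; case: (mu _) => // r _.
  by rewrite -EFinD lee_fin; lra.
have [D aD HD] := (HU m).2 _ e20; exists D => //.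
have mD := alg_measurable aD.
apply: (@le_lt_trans _ _ (mu ((A0 `&` (\bigcup_i B i `\` U m)) `|` (A0 `&` (U m `+` D))))).
  apply: le_measure; rewrite ?inE.
  - exact: mA0Y.
  - by apply: measurableU; [apply: measurableI => //; exact: measurableD|exact: mA0Y].
  - move=> x /=; have := EM (U m x).
    have UB : U m x -> (\bigcup_i B i) x.
      by rewrite /U -bigcup_mkord => -[i _ Bi]; exists i.
    tauto.
rewrite (le_lt_trans (measureU2 _ _ _))//; try exact: mA0Y.
  by apply: measurableI => //; exact: measurableD.
by rewrite [e]splitr EFinD lteD.
Qed.

Lemma sigma_alg_approximable : <<s alg >> `<=` approximable.
Proof.
apply: smallest_sub; last first.
  move=> D aD; split; first exact: alg_measurable.
  move=> e e0; exists D => //; rewrite (_ : _ `&` _ = set0) ?measure0//.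
  by apply/seteqP; split => x //=; tauto.
split.
- split => // e e0; exists set0 => //; rewrite (_ : _ `&` _ = set0) ?measure0//.
  by apply/seteqP; split => x //=; tauto.
- by move=> A; rewrite setTD; exact: approximableC.
- exact: approximable_bigcup.
Qed.

End algebra_approximation.

(** * Dyadic generations and their unions of cells *)

Section grid.
Context (R : realType) (n : nat).
Local Notation mT := (measurableTypeR R).
Local Notation E := (euclidean R n).
Local Notation mu := (lebesgue R n).
Local Notation I2 b a c d := (Interval (BSide b a) (BSide c d)).
Variables (a : 'I_n -> R) (l : R).
Hypothesis l0 : 0 < l.

(** The cells of generation [k] are the fibres of this total function, so they partition the space
    by construction, and nesting becomes a statement about floors. *)
Definition grid_index (k : nat) (x : n.-tuple mT) : {ffun 'I_n -> int} :=
  [ffun i => Num.floor ((tnth x i - a i) / l * 2 ^+ k)].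

Lemma grid_indexE k x i :
  grid_index k x i = Num.floor ((tnth x i - a i) / l * 2 ^+ k).
Proof. by rewrite ffunE. Qed.

Definition grid_corner k (j : {ffun 'I_n -> int}) (i : 'I_n) : R :=
  a i + (j i)%:~R * (l / 2 ^+ k).

Lemma grid_fiber k (j : {ffun 'I_n -> int}) : grid_index k @^-1` [set j] =
  box (fun i => I2 true (grid_corner k j i) true (grid_corner k j i + l / 2 ^+ k)).
Proof.
have lk : 0 < l / 2 ^+ k :> R by rewrite divr_gt0// exprn_gt0.
have floorE (i : 'I_n) (y : R) :
    (Num.floor ((y - a i) / l * 2 ^+ k) == j i) =
    (y \in I2 true (grid_corner k j i) true (grid_corner k j i + l / 2 ^+ k)).
  rewrite floor_eq itv_boundlr !bnd_simp /grid_corner.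
  rewrite (_ : (y - a i) / l * 2 ^+ k = (y - a i) / (l / 2 ^+ k)); last first.
    by rewrite invf_div mulrA mulrAC -mulrA [_ * l^-1]mulrC mulrA.
  rewrite ler_pdivlMr// ltr_pdivrMr// intrD mulrDl mul1r.
  by rewrite lerBrDl ltrBlDl addrA.
apply/seteqP; split => x /=.
  by move=> jE i; rewrite -(floorE i (tnth x i)) -jE grid_indexE.
by move=> H; apply/ffunP => i; rewrite grid_indexE; apply/eqP; rewrite floorE; exact: H.
Qed.

Lemma measurable_grid_index k (S : set {ffun 'I_n -> int}) :
  measurable (grid_index k @^-1` S).
Proof.
rewrite (_ : _ @^-1` _ = \bigcup_j
    (if j \in S then grid_index k @^-1` [set j] else set0)).
  apply: countable_bigcupT_measurable => // j; case: ifP => // _.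
  by rewrite grid_fiber; exact: measurable_box.
apply/seteqP; split => x /=; first by move=> Sx; exists (grid_index k x); rewrite ?mem_set.
by move=> [j _]; case: ifPn => //; rewrite inE => Sj /= ->.
Qed.

(** Passage from a dyadic interval to its parent; Euclidean division by 2 rounds down for negative
    indices too. It makes each generation a function of the next one. *)
Lemma floor_half (u : R) : Num.floor u = (Num.floor (u * 2) %/ 2)%Z.
Proof.
have /andP[H1 H2] := floor_itv (u * 2).
apply/floor_def; set m := Num.floor (u * 2) in H1 H2 *.
have mE := divz_eq m 2; have r0 : (0 <= m %% 2)%Z by exact: modz_ge0.
have r1 : ((m %% 2)%Z < 2)%R by exact: ltz_pmod.
move: (m %/ 2)%Z (m %% 2)%Z mE r0 r1 => q r mE r0 r1.
have {}r1 : r <= 1 by lia.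
move: H1 H2; rewrite mE !intrD intrM.
have : (0 : int)%:~R <= r%:~R :> R by rewrite ler_int.
have : r%:~R <= (1 : int)%:~R :> R by rewrite ler_int.
move: (q%:~R) (r%:~R) => q' r'; rewrite ?mulr1z ?mulr0z -[2%:~R]/(2 : R) => *.
by apply/andP; split; lra.
Qed.

Lemma grid_index_coarser k m x y : (k <= m)%N ->
  grid_index m x = grid_index m y -> grid_index k x = grid_index k y.
Proof.
elim: m => [|m IH]; first by rewrite leqn0 => /eqP->.
rewrite leq_eqVlt => /predU1P[->//|km] xy; apply: IH => //.
apply/ffunP => i; rewrite !grid_indexE [LHS]floor_half [RHS]floor_half.
by rewrite -!mulrA -exprSr !mulrA -!grid_indexE xy.
Qed.

(** All unions of cells of a single generation. Complements stay in the generation, and finite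
    unions are formed in the finer of two generations. *)
Definition grid_sets : set (set (n.-tuple mT)) :=
  [set D | exists k S, D = grid_index k @^-1` S].

Lemma grid_setsC D : grid_sets D -> grid_sets (~` D).
Proof. by move=> [k [S ->]]; exists k, (~` S). Qed.

Lemma grid_sets_finer k m S : (k <= m)%N ->
  exists S', grid_index k @^-1` S = grid_index m @^-1` S'.
Proof.
move=> km; exists (grid_index m @` (grid_index k @^-1` S)).
apply/seteqP; split => x /=; first by move=> Sx; exists x.
by move=> [y Sy /(grid_index_coarser km) <-].
Qed.

Lemma grid_setsU D1 D2 : grid_sets D1 -> grid_sets D2 -> grid_sets (D1 `|` D2).
Proof.
move=> [k1 [S1 ->]] [k2 [S2 ->]].
have [S1' ->] := grid_sets_finer S1 (leq_maxl k1 k2).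
have [S2' ->] := grid_sets_finer S2 (leq_maxr k1 k2).
by exists (maxn k1 k2), (S1' `|` S2').
Qed.

(** These half-spaces generate the Borel sets. One is the union over [k] of the cells lying strictly
    before the cells that meet its boundary: a point below [c] is caught as soon as its distance to
    [c] exceeds the cell side. *)
Lemma sigma_grid_halfspace i (c : R) : <<s grid_sets >> [set x | tnth x i < c].
Proof.
pose v := (c - a i) / l.
rewrite (_ : [set x | _] = \bigcup_k grid_index k @^-1`
    [set j | j i < Num.floor (v * 2 ^+ k)]).
  apply: sigma_algebra_bigcup => k; apply: sub_sigma_algebra.
  by exists k; eexists.
apply/seteqP; split => x /=; last first.
  move=> [k _] /=; rewrite grid_indexE => H.
  rewrite ltNge; apply/negP => cx; move: H; rewrite ltNge => /negP; apply.
  by apply: le_floor; rewrite ler_pM2r ?exprn_gt0// ler_pM2r ?invr_gt0// lerB.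
move=> xc; pose u := (tnth x i - a i) / l.
have uv : 0 < v - u by rewrite /v /u -mulrBl divr_gt0// opprB addrA subrK subr_gt0.
(* By [upper_nthrootP], 2^k exceeds (v - u)^-1, so the scaled values of [u] and [v] are at least 1
   apart and have different floors. *)
exists (Num.bound (v - u)^-1) => //=; set k := Num.bound _.
rewrite grid_indexE -/u -lezD1 floor_ge_int intrD.
have := @upper_nthrootP R (v - u)^-1 k (leqnn _).
rewrite invf_plt ?posrE ?exprn_gt0// => H.
have := floor_le (u * 2 ^+ k); rewrite mulr1z => H1.
have : 1 <= (v - u) * 2 ^+ k.
  by rewrite -ler_pdivrMr ?exprn_gt0// mul1r ltW.
by rewrite mulrBl; lra.
Qed.

Lemma sigma_grid_borel : measurable `<=` <<s grid_sets >>.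
Proof.
apply: smallest_sub; first exact: smallest_sigma_algebra.
rewrite -bigcup_seq/= => D [i _ /= [Y mY <-]]; rewrite setTI.
have : (@RGenInftyO.G R).-sigma.-measurable Y by rewrite -RGenInftyO.measurableE.
pose C := [set Y : set R | <<s grid_sets >> ((@tnth n mT ^~ i) @^-1` Y)].
suff : <<s (@RGenInftyO.G R) >> `<=` C by apply.
apply: smallest_sub; last first.
  move=> _ [c ->]; rewrite /C/=.
  rewrite (_ : _ @^-1` _ = [set x | tnth x i < c]); first exact: sigma_grid_halfspace.
  by apply/seteqP; split => x /=; rewrite in_itv.
split; rewrite /C.
- by rewrite /= preimage_set0; exact: sigma_algebra0.
- move=> A /= HA; rewrite setTD preimage_setC -setTD; exact: sigma_algebraCD.
- by move=> F HF /=; rewrite preimage_bigcup; exact: sigma_algebra_bigcup.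
Qed.

(** [B] is only Lebesgue measurable, whereas the grid generates the Borel sets. Half of [e] is spent
    on a Borel set covering [B], the other half on approximating that set by cells. *)
Lemma grid_approximation (A0 B : set E) (e : R) : measurable A0 -> (mu A0 < +oo)%E ->
  measurable B -> B `<=` A0 -> 0 < e ->
  exists k S, (mu (A0 `&` (B `+` (grid_index k @^-1` S : set E))) < e%:E)%E.
Proof.
move=> mA0 A0fin mB BA0 e0; have e20 : 0 < e / 2 by rewrite divr_gt0.
have muB : mu B \is a fin_num.
  by rewrite ge0_fin_numE// (le_lt_trans _ A0fin)// le_measure ?inE.
have muB' : mu_ext (lebesgue_borel R n) (B : set (n.-tuple mT)) \is a fin_num by [].
(* [mu B] is an outer measure, an infimum over countable Borel covers; [F] is a cover that nearly
   attains it. *)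
have [_ [F [mF BF] <-] HF] := lb_ereal_inf_adherent e20 muB'.
have {}HF : (\sum_(k <oo) lebesgue_borel R n (F k) < mu B + (e / 2)%:E)%E := HF.
pose B' := \bigcup_k F k.
have mB' : measurable B' by exact: bigcupT_measurable.
have mB'E : measurable (B' : set E) by exact: measurable_borel_euclidean.
have B'B : (mu (B' `\` B) <= (e / 2)%:E)%E.
  have B'le : (mu B' <= mu B + (e / 2)%:E)%E.
    rewrite (le_trans _ (ltW HF))// lebesgueE//.
    by apply: measure_sigma_subadditive.
  rewrite measureD//; last first.
    by rewrite (le_lt_trans B'le)// -[mu B]fineK// -EFinD ltry.
  by rewrite setIidr// leeBlDl.
have [] := @sigma_alg_approximable _ E R mu A0 grid_sets mA0 A0fin _ _ _ _ B' _.
- move=> _ [k [S ->]]; apply: measurable_borel_euclidean; exact: measurable_grid_index.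
- by exists 0%N, set0; rewrite preimage_set0.
- exact: grid_setsC.
- exact: grid_setsU.
- exact: sigma_grid_borel.
move=> _ /(_ _ e20)[_ [k [S ->]] HD]; exists k, S.
set D := grid_index k @^-1` S in HD *.
have mD : measurable (D : set E).
  by apply: measurable_borel_euclidean; exact: measurable_grid_index.
have mY X Y : measurable X -> measurable Y -> measurable (A0 `&` (X `+` Y)).
  by move=> mX mY; apply: measurableI => //; apply: measurableU; exact: measurableD.
apply: (@le_lt_trans _ _ (mu ((B' `\` B) `|` (A0 `&` (B' `+` D))))).
  apply: le_measure; rewrite ?inE.
  - exact: mY.
  - by apply: measurableU; [exact: measurableD|exact: mY].
  - by move=> x /=; have := EM (B' x); have := BF x; tauto.
rewrite (le_lt_trans (measureU2 _ _ _))//; try exact: mY.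
  exact: measurableD.
by rewrite [e]splitr EFinD lee_ltD// ge0_fin_numE// (le_lt_trans B'B)// ltry.
Qed.

End grid.

Section calderon_zygmund.
Context (R : realType) (n : nat).
Local Notation mT := (measurableTypeR R).
Local Notation E := (euclidean R n).
Local Notation mu := (lebesgue R n).
Local Notation I2 b a c d := (Interval (BSide b a) (BSide c d)).
Variables (a : 'I_n -> R) (l : R).
Hypothesis l0 : 0 < l.
Local Notation J := {ffun 'I_n -> int}.
Local Notation idx := (grid_index a l).

Definition open_cube : set E := box (fun i => I2 false (a i) true (a i + l)).

Lemma open_cubeP x : open_cube x <-> forall i, a i < coordinate x i < a i + l.
Proof. by split => H i; have := H i; rewrite in_itv. Qed.

Lemma is_cube_open_cube : is_cube open_cube.
Proof. by exists a, l, (fun=> false), (fun=> true). Qed.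

Lemma volume_open_cube : volume open_cube = l ^+ n.
Proof. by rewrite /volume lebesgue_box. Qed.

(* Intersecting with the open cube keeps the cells inside any cube with this interior;
   this only opens lower faces, which [is_cube] allows. *)
Definition cell k (j : J) : set E := open_cube `&` (idx k @^-1` [set j]).

Lemma grid_index_bounds k x i : open_cube x -> 0 <= idx k x i < 2 ^+ k.
Proof.
move=> /open_cubeP/(_ i)/andP[ax xa]; rewrite grid_indexE.
rewrite floor_ge0 floor_lt_int mulr_ge0//=; last first.
  by rewrite divr_ge0 ?(ltW l0)// subr_ge0 ltW.
rewrite rmorphXn/= -[X in _ < X]mul1r ltr_pM2r ?exprn_gt0//.
by rewrite ltr_pdivrMr// mul1r ltrBlDl.
Qed.

(** A cell loses its lower face in direction [i] exactly when [j i = 0]. Its upper bound never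
    passes that of the cube, since j i < 2^k means j i + 1 <= 2^k. The point [x0] supplies these
    bounds on [j]. *)
Lemma cellP k j x0 : cell k j x0 ->
  cell k j = [set x | forall i, coordinate x i \in
    I2 (j i != 0) (grid_corner a l k j i) true (grid_corner a l k j i + l / 2 ^+ k)].
Proof.
move=> [x0Q jE]; have jb i := grid_index_bounds k i x0Q; rewrite jE in jb.
have h0 : 0 < l / 2 ^+ k :> R by rewrite divr_gt0// exprn_gt0.
have lE : l = 2 ^+ k * (l / 2 ^+ k) by rewrite mulrC divfK// gt_eqF// exprn_gt0.
rewrite /cell grid_fiber// /open_cube; set h := l / 2 ^+ k in h0 lE *.
have cE i : grid_corner a l k j i = a i + (j i)%:~R * h by [].
have jk i : (j i)%:~R + 1 <= 2 ^+ k :> R.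
  have /andP[_] := jb i; rewrite -lezD1 => jk.
  have : (j i + 1)%:~R <= (2 ^+ k : int)%:~R :> R by rewrite ler_int.
  by rewrite intrD rmorphXn.
have ub i : a i + (j i)%:~R * h + h <= a i + l.
  rewrite -addrA lerD2l [leRHS]lE -{2}[h]mul1r -mulrDl ler_pM2r//.
apply/seteqP; split => x /=.
  move=> [xQ xf] i; move: (xQ i) (xf i) => /=; rewrite ?in_itv/= => /andP[ax xa] /andP[cx xc].
  case: eqVneq => [j0|j0] /=; rewrite ?in_itv/= xc andbT//.
  by rewrite cE j0 mul0r addr0.
move=> H; split => i /=; have := H i.
  case: eqVneq => [j0|j0] /=; rewrite ?in_itv/= cE => /andP[cx xc]; apply/andP; split.
  - by move: cx; rewrite j0 mul0r addr0.
  - exact: lt_le_trans xc (ub i).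
  - apply: lt_le_trans cx; rewrite ltrDl mulr_gt0// ltr0z lt_def j0.
    by have /andP[] := jb i.
  - exact: lt_le_trans xc (ub i).
by case: eqVneq => [j0|j0] /=; rewrite ?in_itv/= => /andP[cx ->]; rewrite andbT ?(ltW cx).
Qed.

Lemma is_cube_cell k j : cell k j !=set0 -> is_cube (cell k j).
Proof.
move=> [x0 /cellP ->].
exists (grid_corner a l k j), (l / 2 ^+ k), (fun i => j i != 0), (fun=> true).
by split => //; rewrite divr_gt0// exprn_gt0.
Qed.

Lemma volume_cell k j : cell k j !=set0 -> volume (cell k j) = (l / 2 ^+ k) ^+ n.
Proof.
by move=> [x0 /cellP ->]; rewrite /volume lebesgue_box// divr_gt0// exprn_gt0.
Qed.

Lemma measurable_cell k j : measurable (cell k j).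
Proof.
apply: measurableI; first exact: cube_measurable is_cube_open_cube.
by apply: measurable_borel_euclidean; exact: measurable_grid_index.
Qed.

End calderon_zygmund.

(** * Calderon-Zygmund decomposition *)

Section calderon_zygmund_open.
Context (R : realType) (n : nat).
Local Notation E := (euclidean R n).
Local Notation mu := (lebesgue R n).
Variables (a : 'I_n -> R) (l : R).
Hypothesis l0 : 0 < l.
Local Notation J := {ffun 'I_n -> int}.
Local Notation idx := (grid_index a l).
Local Notation U := (open_cube a l).
Local Notation cell := (cell a l).
Variables (g : E -> R) (lam : R).
Hypotheses (g0 : forall x, 0 <= g x) (lam0 : 0 < lam)
  (gi : mu.-integrable U (EFin \o g))
  (gU : \int[mu]_(x in U) g x <= lam * volume U).

Let mU : measurable U := cube_measurable (is_cube_open_cube a l0).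
Let muU : mu U = (volume U)%:E := (cube_measure (is_cube_open_cube a l0)).1.
Let mcell := measurable_cell (n := n) a l0.

Let cell_sub k j : cell k j `<=` U. Proof. by move=> x []. Qed.

Let gi_sub A : measurable A -> A `<=` U -> mu.-integrable A (EFin \o g).
Proof. by move=> mA AU; exact: integrableS gi. Qed.

Let Rint_sub A B : measurable A -> measurable B -> A `<=` B -> B `<=` U ->
  \int[mu]_(x in A) g x <= \int[mu]_(x in B) g x.
Proof.
move=> mA mB AB BU; rewrite fine_le//.
- by apply: integrable_fin_num => //; apply: gi_sub => //; exact: subset_trans BU.
- by apply: integrable_fin_num => //; exact: gi_sub.
apply: (@ge0_subset_integral _ _ _ mu A B mA mB (EFin \o g) _ _ AB).
  exact: measurable_int (gi_sub mB BU).
by move=> x _; rewrite lee_fin.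
Qed.

Let bad k j := lam * volume (cell k j) < \int[mu]_(x in cell k j) g x.

(** For [x] in the cell, the [idx i x] with [i < k] are its proper ancestors, so the stopping cells
    are the maximal bad ones. *)
Let stop k j := [/\ cell k j !=set0, bad k j &
  forall x i, cell k j x -> (i < k)%N -> ~ bad i (idx i x)].

(* [pickle_inv] enumerates the pairs (generation, index) without repetition, which
   makes the selected cells pairwise disjoint. *)
Let F (m : nat) : set E := if @pickle_inv (nat * J)%type m is Some (k, j) then
  (if `[< stop k j >] then cell k j else set0) else set0.

Let FP m : F m = set0 \/ exists k j, [/\ @pickle_inv (nat * J)%type m = Some (k, j),
  stop k j & F m = cell k j].
Proof.
rewrite /F; case: pickle_inv => [[k j]|]; last by left.
by case: asboolP; [right; exists k, j|left].
Qed.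

Let F_sub m : F m `<=` U.
Proof. by have [->//|[k [j [_ _ ->]]]] := FP m; exact: cell_sub. Qed.

Let mF m : measurable (F m).
Proof. by have [->//|[k [j [_ _ ->]]]] := FP m. Qed.

(** Two stopping cells with a common point have the same generation, since otherwise the coarser
    would be a bad ancestor of the finer. They are then fibres over the same index, and [pickle_inv]
    lists each pair once. *)
Let F_triv : trivIset setT F.
Proof.
move=> m m' _ _ [x [Fmx Fm'x]].
have [FE|[k [j [mE [_ kbad ksm] FE]]]] := FP m; first by rewrite FE in Fmx.
have [FE'|[k' [j' [m'E [_ kbad' ksm'] FE']]]] := FP m'; first by rewrite FE' in Fm'x.
rewrite FE in Fmx; rewrite FE' in Fm'x.
have jE : idx k x = j by case: Fmx.
have jE' : idx k' x = j' by case: Fm'x.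
case: (ltngtP k k') => kk'.
- by have := ksm' _ _ Fm'x kk'; rewrite jE.
- by have := ksm _ _ Fmx kk'; rewrite jE'.
have jj' : j = j' by rewrite -jE -jE' kk'.
have := @pickle_invK (nat * J)%type m; rewrite mE /= => <-.
have := @pickle_invK (nat * J)%type m'; rewrite m'E /= => <-.
by rewrite kk' jj'.
Qed.

Let F_cover x : U x -> (exists k, bad k (idx k x)) -> (\bigcup_m F m) x.
Proof.
move=> Ux [k0 bk0]; pose P k := `[< bad k (idx k x) >].
have exP : exists k, P k by exists k0; exact/asboolP.
case: (ex_minnP exP) => k /asboolP bk kmin.
have cx : cell k (idx k x) x by [].
exists (pickle (k, idx k x)) => //; rewrite /F pickleK_inv asboolT//.
split => //; first by exists x.
(* The minimality of [k] was chosen at [x], but all points of the cell have the same ancestors. *)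
move=> y i [Uy /= yx] ik bi; have /asboolP/kmin : bad i (idx i x).
  by rewrite -(grid_index_coarser (a := a) l0 (ltnW ik) yx).
by rewrite leqNgt ik.
Qed.

Let F_cube m : F m = set0 \/ is_cube (F m).
Proof.
by have [->|[k [j [_ [cn _ _] ->]]]] := FP m; [left|right; exact: is_cube_cell].
Qed.

Let volume0 : volume (set0 : set E) = 0.
Proof. by rewrite /volume measure0. Qed.

Let F_lower m : lam * volume (F m) <= \int[mu]_(x in F m) g x.
Proof.
have [->|[k [j [_ [_ /ltW ? _] ->]]]] := FP m => //.
by rewrite volume0 mulr0 Rintegral_set0.
Qed.

(** The parent of a stopping cell is not bad, contains the cell, and has 2^n times its volume. *)
Let F_upper m : \int[mu]_(x in F m) g x <= 2 ^+ n * lam * volume (F m).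
Proof.
have [->|[k [j [_ [[x0 x0c] kbad ks] ->]]]] := FP m.
  by rewrite volume0 mulr0 Rintegral_set0.
have [Ux0 /= jE] := x0c.
case: k => [|k] in x0c kbad ks jE *.
  (* The only nonempty cell of generation 0 is [U], and it is not bad by [gU]; hence every stopping
     cell has a parent. *)
  exfalso; move: kbad; rewrite /bad.
  suff -> : cell 0%N j = U by rewrite ltNge gU.
  apply/seteqP; split => [x []//|x Ux]; split => //=; rewrite -jE.
  apply/ffunP => i.
  have idx0 y : U y -> idx 0%N y i = 0.
    move=> Uy; have /andP[y0] := grid_index_bounds (a := a) l0 0%N i Uy.
    by rewrite expr0 -[1]add0r ltzD1 => y1; apply/le_anti/andP.
  by rewrite !idx0.
have := ks x0 k x0c (leqnn _); rewrite /bad => /negP; rewrite -leNgt.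
have cn' : cell k (idx k x0) !=set0 by exists x0.
have cn : cell k.+1 j !=set0 by exists x0.
rewrite (volume_cell l0 cn') (volume_cell l0 cn) => H.
apply: (@le_trans _ _ (\int[mu]_(x in cell k (idx k x0)) g x)).
  apply: Rint_sub => // x [Ux /= xj]; split => //=.
  by apply: (grid_index_coarser (a := a) l0 (leqnSn k)); rewrite xj.
rewrite (le_trans H)// mulrAC -mulrA [lam * _]mulrC mulrA ler_pM2r//.
rewrite -exprMn le_eqVlt; apply/orP; left; apply/eqP; congr (_ ^+ _).
by rewrite exprS; field; rewrite ?expf_neq0.
Qed.

Let F_sum M : lam * \sum_(m < M) volume (F m) <= \int[mu]_(x in U) g x.
Proof.
apply: (@le_trans _ _ (\sum_(m < M) \int[mu]_(x in F m) g x)).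
  by rewrite mulr_sumr; apply: ler_sum.
rewrite -lee_fin -sumEFin fineK; last exact: integrable_fin_num.
apply: (@le_trans _ _ (\sum_(m <- index_iota 0 M) \int[mu]_(x in F m) (g x)%:E)%E).
  rewrite big_mkord; apply: lee_sum => m _; rewrite fineK//.
  by apply: integrable_fin_num => //; apply: gi_sub.
have FU : \big[setU/set0]_(m <- index_iota 0 M) F m `<=` U.
  by rewrite -bigcup_seq; apply: bigcup_sub => m _; exact: F_sub.
have mFU : measurable (\big[setU/set0]_(m <- index_iota 0 M) F m).
  by apply: bigsetU_measurable => m _; exact: mF.
rewrite -(@ge0_integral_bigsetU _ _ _ mu _ F (EFin \o g) (index_iota 0 M) mF (iota_uniq _ _)).
- apply: (@ge0_subset_integral _ _ _ mu _ U mFU mU (EFin \o g) _ _ FU).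
    exact: measurable_int gi.
  by move=> x _; rewrite lee_fin.
- exact: sub_trivIset F_triv.
- exact: measurable_int (gi_sub mFU FU).
- by move=> x _; rewrite lee_fin.
Qed.

(** The last clause holds because a bad cell is covered by the [F m]. It keeps the information on
    all generations from which the almost everywhere bound is deduced. *)
Lemma calderon_zygmund_open : exists F : nat -> set E,
  [/\ forall m, (F m = set0 \/ is_cube (F m)) /\ F m `<=` U,
      trivIset setT F,
      forall m, \int[mu]_(x in F m) g x <= 2 ^+ n * lam * volume (F m),
      forall M, lam * \sum_(m < M) volume (F m) <= \int[mu]_(x in U) g x &
      forall k j, cell k j `\` \bigcup_m F m !=set0 ->
        \int[mu]_(x in cell k j) g x <= lam * volume (cell k j)].
Proof.
exists F; split => //.
move=> k j [x [[Ux /= xj] xF]]; rewrite leNgt; apply/negP => kbad; apply: xF.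
by apply: F_cover => //; exists k; rewrite xj.
Qed.

End calderon_zygmund_open.

(** * From means over dyadic cells to an almost everywhere bound *)

Section grid_differentiation.
Context (R : realType) (n : nat).
Local Notation E := (euclidean R n).
Local Notation mu := (lebesgue R n).
Variables (a : 'I_n -> R) (l : R).
Hypothesis l0 : 0 < l.
Local Notation J := {ffun 'I_n -> int}.
Local Notation idx := (grid_index a l).
Local Notation U := (open_cube a l).
Local Notation cell := (cell a l).
Variables (g : E -> R) (lam : R) (Om : set E).
Hypotheses (g0 : forall x, 0 <= g x) (lam0 : 0 < lam)
  (gi : mu.-integrable U (EFin \o g)) (mOm : measurable Om)
  (gcell : forall k j, cell k j `\` Om !=set0 ->
    \int[mu]_(x in cell k j) g x <= lam * volume (cell k j)).

Let mU : measurable U := cube_measurable (is_cube_open_cube a l0).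
Let muU : mu U = (volume U)%:E := (cube_measure (is_cube_open_cube a l0)).1.
Let mcell := measurable_cell (n := n) a l0.
Let Ufin : (mu U < +oo)%E. Proof. by rewrite muU ltry. Qed.

(** Cells inside [Om] do not meet the domain on the left; on the others [gcell] applies. The sets
    [C m] enumerate these cells without repetition, so the bounds add up. *)
Let integral_grid_set_le k (S : set J) :
  (\int[mu]_(x in (U `&` (idx k @^-1` S : set E)) `\` Om) (g x)%:E <=
   lam%:E * mu (U `&` (idx k @^-1` S : set E)))%E.
Proof.
set D := U `&` _.
pose C (m : nat) : set E := if @pickle_inv J m is Some j then
  (if `[< S j /\ cell k j `\` Om !=set0 >] then cell k j else set0) else set0.
have CP m : C m = set0 \/ exists j, [/\ @pickle_inv J m = Some j,
    S j /\ cell k j `\` Om !=set0 & C m = cell k j].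
  rewrite /C; case: pickle_inv => [j|]; last by left.
  by case: asboolP; [right; exists j|left].
have mC m : measurable (C m).
  by have [->|[j [_ _ ->]]] := CP m; [exact: measurable0|exact: mcell].
have CD m : C m `<=` D.
  have [->|[j [_ [Sj _] ->]]] := CP m; first exact: sub0set.
  by move=> x [Ux /= xj]; split => //=; rewrite xj.
have tC : trivIset setT C.
  move=> m m' _ _ [x [Cm Cm']].
  have [CE|[j [mE _ CE]]] := CP m; first by rewrite CE in Cm.
  have [CE'|[j' [m'E _ CE']]] := CP m'; first by rewrite CE' in Cm'.
  rewrite CE in Cm; rewrite CE' in Cm'.
  have jj' : j = j' by case: Cm => _ /= <-; case: Cm'.
  have := @pickle_invK J m; rewrite mE /= => <-.
  have := @pickle_invK J m'; rewrite m'E /= => <-.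
  by rewrite jj'.
have mD : measurable D.
  apply: measurableI => //; apply: measurable_borel_euclidean.
  exact: measurable_grid_index.
have mUC : measurable (\bigcup_m C m) by exact: bigcupT_measurable.
have UCD : \bigcup_m C m `<=` D by apply: bigcup_sub => m _; exact: CD.
have DU : D `<=` U by move=> x [].
have mg A : A `<=` U -> measurable A -> measurable_fun A (EFin \o g).
  by move=> AU mA; apply: (@measurable_funS _ _ _ _ U) => //; exact: measurable_int gi.
apply: (@le_trans _ _ (\int[mu]_(x in \bigcup_m C m) (g x)%:E)%E).
  have mDO : measurable (D `\` Om) by exact: measurableD.
  apply: (@ge0_subset_integral _ _ _ mu _ _ mDO mUC (EFin \o g)).
  - by apply: mg => //; exact: subset_trans DU.
  - by move=> x _; rewrite lee_fin.
  - move=> x [[Ux /= Sx] Ox]; exists (pickle (idx k x)) => //.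
    by rewrite /C pickleK_inv asboolT//; split => //; exists x.
rewrite (@ge0_integral_bigcup _ _ _ mu C (EFin \o g) mC).
- apply: (@le_trans _ _ (\sum_(m <oo) (lam%:E * mu (C m)))%E).
    apply: lee_nneseries => m _.
      by move=> _; apply: integral_ge0 => x _; rewrite lee_fin.
    have [->|[j [_ [_ jn] ->]]] := CP m.
      by rewrite integral_set0 measure0 mule0.
    have cn : cell k j !=set0 by case: jn => x [cx _]; exists x.
    rewrite (cube_measure (is_cube_cell l0 cn)).1 -EFinM.
    rewrite -[leLHS]fineK ?lee_fin; first exact: gcell.
    apply: integrable_fin_num; first exact: mcell.
    apply: (@integrableS _ _ _ mu U) => //; exact: subIsetl.
  rewrite nneseriesZl; last by move=> m _; exact: measure_ge0.
  rewrite lee_wpmul2l ?lee_fin ?(ltW lam0)//.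
  have <- : mu (\bigcup_m C m) = (\sum_(m <oo) mu (C m))%E.
    by apply/esym/cvg_lim => //; exact: (measure_semi_sigma_additive C mC tC mUC).
  by apply: le_measure; rewrite ?inE.
- by apply: mg => //; exact: subset_trans DU.
- by move=> x _; rewrite lee_fin.
- exact: tC.
Qed.

(* A set lying above the level [lam + t] is approximated by a union of cells, where the
   mean of [g] is at most [lam]. *)
Let gap t : 0 < t -> mu ((U `\` Om) `&` (U `&` g @^-1` `]lam + t, +oo[%classic)) = 0%E.
Proof.
move=> t0; set B := _ `&` _.
have mB : measurable B.
  apply: measurableI; first exact: measurableD.
  have /measurable_EFinP mg : measurable_fun U (EFin \o g) := measurable_int _ gi.
  by apply: mg.
have BU : B `<=` U by move=> x [[]].
have finU A : measurable A -> A `<=` U -> mu A \is a fin_num.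
  move=> mA AU; rewrite ge0_fin_numE// (le_lt_trans _ Ufin)//.
  by apply: le_measure; rewrite ?inE.
apply/eqP; rewrite eq_le measure_ge0 andbT.
rewrite -[mu B]fineK ?finU// lee_fin; set b := fine _.
apply/ler_addgt0Pr => e e0; rewrite add0r.
(* Chosen so that (lam + t) e' = t e. *)
pose e' := e * (t / (lam + t)).
have lt0 : 0 < lam + t by exact: addr_gt0.
have e'0 : 0 < e' by rewrite mulr_gt0// divr_gt0.
have [k [S HS]] := grid_approximation a l0 mU Ufin mB BU e'0.
set D : set E := idx k @^-1` S in HS.
have mD : measurable D.
  by apply: measurable_borel_euclidean; exact: measurable_grid_index.
have mBD : measurable (B `&` D) by exact: measurableI.
have mUD : measurable (U `&` D) by exact: measurableI.
have mY : measurable (U `&` (B `+` D)).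
  by apply: measurableI => //; apply: measurableU; exact: measurableD.
have fBD := finU _ mBD (subset_trans (@subIsetl _ B D) BU).
have fUD := finU _ mUD (@subIsetl _ U D).
have fY := finU _ mY (@subIsetl _ U _).
have mUDO : measurable ((U `&` D) `\` Om) by exact: measurableD.
have H1 := integral_grid_set_le k S; rewrite -/D in H1.
have gUDO : measurable_fun ((U `&` D) `\` Om) (EFin \o g).
  apply: (@measurable_funS _ _ _ _ U) => //; first by move=> x [[]].
  exact: measurable_int gi.
have BDsub : B `&` D `<=` (U `&` D) `\` Om by move=> x [[[Ux Ox] _] Dx].
(* On [B] the function exceeds [lam + t], while its integral over [D] off [Om] is at most [lam]
   times the measure of [D] in [U]. Since [B] and [D] differ in [U] by a set of measure y < e', this
   gives t mu(B) <= (lam + t) y <= t e. *)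
have H2 : ((lam + t)%:E * mu (B `&` D) <= lam%:E * mu (U `&` D))%E.
  apply: le_trans H1.
  rewrite -integral_cst//.
  apply: (@le_trans _ _ (\int[mu]_(x in B `&` D) (g x)%:E)%E).
    have gBD : measurable_fun (B `&` D) (EFin \o g) := measurable_funS mUDO BDsub gUDO.
    apply: (@ge0_le_integral _ _ _ mu _ mBD (fun=> (lam + t)%:E) (EFin \o g) _ _ gBD).
    - by move=> x _; rewrite lee_fin ltW.
    - exact: measurable_cst.
    - move=> x [[_ [_ /= Hx]] _]; rewrite lee_fin.
      by move: Hx; rewrite in_itv/= andbT => /ltW.
  apply: (@ge0_subset_integral _ _ _ mu _ _ mBD mUDO (EFin \o g)) => //.
  by move=> x _; rewrite lee_fin.
have H3 : (mu (U `&` D) <= mu (B `&` D) + mu (U `&` (B `+` D)))%E.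
  apply: (@le_trans _ _ (mu ((B `&` D) `|` (U `&` (B `+` D))))).
    apply: le_measure; rewrite ?inE//; first exact: measurableU.
    by move=> x [Ux Dx]; have := EM (B x); rewrite /=; tauto.
  exact: measureU2.
have H4 : (mu B <= mu (B `&` D) + mu (U `&` (B `+` D)))%E.
  apply: (@le_trans _ _ (mu ((B `&` D) `|` (U `&` (B `+` D))))).
    apply: le_measure; rewrite ?inE//; first exact: measurableU.
    by move=> x Bx; have := EM (D x); have := BU x Bx; rewrite /=; tauto.
  exact: measureU2.
move: H2 H3 H4 HS.
rewrite -(fineK fBD) -(fineK fUD) -(fineK fY) -(fineK (finU _ mB BU)) -/b.
set be := fine (mu (B `&` D)); set de := fine (mu (U `&` D)); set y := fine _.
rewrite -!EFinM -!EFinD !lee_fin lte_fin => H2 H3 H4 HS.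
have H5 : t * be <= lam * y.
  have := le_trans H2 (ler_wpM2l (ltW lam0) H3); rewrite mulrDl mulrDr.
  by rewrite lerD2l.
have H6 : t * b <= (lam + t) * y.
  rewrite (le_trans (ler_wpM2l (ltW t0) H4))// mulrDr mulrDl.
  by rewrite lerD2r.
have H7 : t * b <= t * e.
  rewrite (le_trans H6)// (le_trans (ler_wpM2l (ltW lt0) (ltW HS)))// /e'.
  by rewrite le_eqVlt; apply/orP; left; apply/eqP; field; rewrite gt_eqF.
by rewrite -(ler_pM2l t0).
Qed.

Lemma grid_ae_le : {ae mu, forall x, U x -> ~ Om x -> g x <= lam}.
Proof.
suff H : mu.-negligible (\bigcup_m ((U `\` Om) `&`
    (U `&` g @^-1` `]lam + m.+1%:R^-1, +oo[%classic))).
  apply: negligibleS H => x /= /existsNP[Ux /existsNP[Ox /negP]]; rewrite -ltNge => lg.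
  have := @ltr_add_invr R lam (g x) lg => -[m Hm].
  by exists m => //; split => //; split => //=; rewrite in_itv/= Hm.
apply: negligible_bigcup => m; apply/negligibleP; last exact: gap.
apply: measurableI; first exact: measurableD.
have /measurable_EFinP mg : measurable_fun U (EFin \o g) := measurable_int _ gi.
by apply: mg.
Qed.

End grid_differentiation.

Section calderon_zygmund_cube.
Context (R : realType) (n : nat).
Local Notation E := (euclidean R n).
Local Notation mu := (lebesgue R n).

(** The faces are null because the volume of a box does not depend on which of them it contains. *)
Lemma cube_interior (Q : set E) : is_cube Q -> exists (a : 'I_n -> R) (l : R),
  [/\ 0 < l, open_cube a l `<=` Q, mu (Q `\` open_cube a l) = 0%E &
      volume Q = volume (open_cube a l)].
Proof.
move=> cQ; have [a [l [lo [hi [l0 QE]]]]] := cQ.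
have UQ : open_cube a l `<=` Q.
  move=> x /open_cubeP Ux; rewrite QE => i; have /andP[ax xa] := Ux i.
  rewrite itv_boundlr; apply/andP.
  by split; [case: (lo i)|case: (hi i)]; rewrite bnd_simp ?ltW.
have vE : volume Q = volume (open_cube a l).
  by rewrite volume_open_cube// /volume QE lebesgue_box.
exists a, l; split => //.
have cU := is_cube_open_cube a l0.
have mU := cube_measurable cU; have mQ := cube_measurable cQ.
have Qfin : (mu Q < +oo)%E by rewrite (cube_measure cQ).1 ltry.
rewrite (measureD mQ mU Qfin).
rewrite setIidr//; transitivity ((volume Q)%:E - (volume (open_cube a l))%:E)%E.
  by congr (_ - _)%E; [exact: (cube_measure cQ).1|exact: (cube_measure cU).1].
by rewrite vE -EFinB subrr.
Qed.

(* The cubes selected are the maximal dyadic subcubes of the interior of [Q] on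
   which the mean of [g] exceeds [lam]. *)
Lemma calderon_zygmund (Q : set E) (g : E -> R) (lam : R) : is_cube Q ->
  (forall x, 0 <= g x) -> 0 < lam -> mu.-integrable Q (EFin \o g) ->
  \int[mu]_(x in Q) g x <= lam * volume Q ->
  exists F : nat -> set E,
  [/\ forall m, (F m = set0 \/ is_cube (F m)) /\ F m `<=` Q,
      trivIset setT F,
      forall m, \int[mu]_(x in F m) g x <= 2 ^+ n * lam * volume (F m),
      forall M, lam * \sum_(m < M) volume (F m) <= \int[mu]_(x in Q) g x &
      {ae mu, forall x, Q x -> ~ (\bigcup_m F m) x -> g x <= lam}].
Proof.
move=> cQ g0 lam0 gi gQ; have [a [l [l0 UQ QU0 vE]]] := cube_interior cQ.
have mQ := cube_measurable cQ; have mU := cube_measurable (is_cube_open_cube a l0).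
have giU : mu.-integrable (open_cube a l) (EFin \o g) by exact: integrableS gi.
have gUQ : \int[mu]_(x in open_cube a l) g x <= \int[mu]_(x in Q) g x.
  rewrite fine_le; [by []| | |].
  - exact: integrable_fin_num.
  - exact: integrable_fin_num.
  - apply: (@ge0_subset_integral _ _ _ mu _ _ mU mQ (EFin \o g) _ _ UQ).
      exact: measurable_int gi.
    by move=> x _; rewrite lee_fin.
have gU : \int[mu]_(x in open_cube a l) g x <= lam * volume (open_cube a l).
  by rewrite -vE; exact: le_trans gQ.
have [F [Fc Ft Fu Fs Fcell]] :=
  calderon_zygmund_open l0 g0 lam0 giU gU.
have mF : measurable (\bigcup_m F m).
  apply: bigcupT_measurable => m; have [[->|/cube_measurable//] _] := Fc m.
  exact: measurable0.
exists F; split => //.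
- by move=> m; have [? FU] := Fc m; split => //; exact: subset_trans FU UQ.
- by move=> M; exact: le_trans (Fs M) gUQ.
have H := grid_ae_le l0 g0 lam0 giU mF Fcell.
have N : mu.-negligible (Q `\` open_cube a l).
  by apply/negligibleP => //; exact: measurableD.
apply: negligibleS (negligibleU H N) => x /= /existsNP[Qx /existsNP[Fx gx]].
have [Ux|Ux] := EM (open_cube a l x); last by right.
by left => /(_ Ux Fx).
Qed.

End calderon_zygmund_cube.

(** * The self-improving estimate *)

Section powR_inequalities.
Context (R : realType).
Implicit Types (x y r q : R).

Lemma weighted_young r x y : 0 < r < 1 -> 0 <= x -> 0 <= y ->
  x `^ (1 - r) * y `^ r <= (1 - r) * x + r * y.
Proof.
move=> /andP[r0 r1] x0 y0; have r1' : 0 < 1 - r by rewrite subr_gt0.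
have := @conjugate_powR R (x `^ (1 - r)) (y `^ r) (1 - r)^-1 r^-1.
rewrite !powR_ge0 !invr_gt0 r0 r1' !invrK subrK -!powRrM !mulfV ?gt_eqF//.
by rewrite !powRr1// ![_ * (_ - _)]mulrC [y * r]mulrC; apply.
Qed.

(** Hoelder with exponents 1 / (1 - r) and 1 / r: Young's inequality for x m / X and y m / Y, whose
    right-hand sides sum to at most (1 - r) + r = 1. *)
Lemma sum_powR_le r (x y : nat -> R) M (X Y : R) : 0 < r < 1 -> 0 < X -> 0 < Y ->
  (forall m, 0 <= x m) -> (forall m, 0 <= y m) ->
  \sum_(m < M) x m <= X -> \sum_(m < M) y m <= Y ->
  \sum_(m < M) x m `^ (1 - r) * y m `^ r <= X `^ (1 - r) * Y `^ r.
Proof.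
move=> r01 X0 Y0 x0 y0 xX yY; have /andP[r0 r1] := r01.
have XY0 : 0 < X `^ (1 - r) * Y `^ r by rewrite mulr_gt0// powR_gt0.
apply: (@le_trans _ _ (\sum_(m < M) (X `^ (1 - r) * Y `^ r) *
    ((1 - r) * (x m / X) + r * (y m / Y)))).
  apply: ler_sum => m _.
  have -> : x m `^ (1 - r) * y m `^ r = (X `^ (1 - r) * Y `^ r) *
      ((x m / X) `^ (1 - r) * (y m / Y) `^ r).
    rewrite mulrACA -!powRM ?divr_ge0 ?(ltW X0) ?(ltW Y0)//.
    by rewrite ![_ * (_ / _)]mulrC !divfK ?gt_eqF.
  rewrite ler_pM2l// weighted_young// divr_ge0// ltW//.
rewrite -mulr_sumr -[leRHS]mulr1 ler_pM2l// big_split/= -!mulr_sumr -!mulr_suml.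
have : (\sum_(m < M) x m) / X <= 1 by rewrite ler_pdivrMr// mul1r.
have : (\sum_(m < M) y m) / Y <= 1 by rewrite ler_pdivrMr// mul1r.
move: (_ / X) (_ / Y) => u v v1 u1.
have := ler_wpM2l (ltW r0) v1; have : (1 - r) * u <= (1 - r) * 1.
  by rewrite ler_wpM2l// subr_ge0 ltW.
by rewrite !mulr1; lra.
Qed.

Lemma powRD_le q x y : 0 <= q -> 0 <= x -> 0 <= y ->
  (x + y) `^ q <= 2 `^ q * (x `^ q + y `^ q).
Proof.
move=> q0 x0 y0; wlog xy : x y x0 y0 / x <= y.
  move=> H; have [/H->//|/ltW /H] := leP x y.
  by rewrite addrC [y `^ _ + _]addrC; apply.
apply: (@le_trans _ _ ((2 * y) `^ q)).
  by apply: ge0_ler_powR; rewrite // ?nnegrE ?addr_ge0 ?mulr_ge0//; lra.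
by rewrite powRM// ler_wpM2l ?powR_ge0// lerDr powR_ge0.
Qed.

End powR_inequalities.

Section good_lambda.
Context (R : realType) (n : nat).
Local Notation E := (euclidean R n).
Local Notation mu := (lebesgue R n).
Local Notation ev P x := (mpoly.meval (coordinate x) P).
Variables (s : nat) (p q : R) (X : set E) (f : E -> R).
Hypotheses (q1 : 1 <= q) (qp : q < p).
Hypothesis fi : forall Q, is_cube Q -> Q `<=` X -> mu.-integrable Q (EFin \o f).

Definition residual (Q : set E) (x : E) : R :=
  `|f x - ev (moment_projection s f Q) x|.
Local Notation u := residual.

Variables (W : set E -> R) (delta T : R).
Hypotheses (d0 : 0 < delta) (T0 : 0 < T) (W0 : W set0 = 0)
  (Wdelta : forall Q, is_cube Q -> Q `<=` X -> delta * volume Q <= W Q)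
  (Wres : forall Q, is_cube Q -> Q `<=` X ->
    volume Q * ((volume Q)^-1 * \int[mu]_(x in Q) u Q x) `^ p <= W Q)
  (Wsum : forall Q (F : nat -> set E), is_cube Q -> Q `<=` X ->
    (forall m, (F m = set0 \/ is_cube (F m)) /\ F m `<=` Q) -> trivIset setT F ->
    forall M, \sum_(m < M) W (F m) <= W Q).

Let r := q / p.
Let p0 : 0 < p. Proof. exact: lt_le_trans (lt_le_trans ltr01 q1) (ltW qp). Qed.
Let q0 : 0 < q. Proof. exact: lt_le_trans ltr01 q1. Qed.
Let r01 : 0 < r < 1.
Proof. by rewrite /r divr_gt0//= ltr_pdivrMr// mul1r. Qed.

Let trunc Q x := (Num.min (u Q x) T) `^ q.
(** Equal to a^q |Q| for a = (W(Q) / |Q|)^(1/p), hence of the order of the bounded part of the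
    integral, and at the same time of the form to which Hoelder applies. *)
Let size Q := (volume Q) `^ (1 - r) * (W Q) `^ r.

(* Chosen so that [2 `^ q * level_cst `^ (r - 1) = 1 / 2]. *)
Definition level_cst : R := 2 `^ ((q + 1) / (1 - r)).
(** The square comes from comparing two projections on a selected cube, the other factor from the
    mean of the residual there. *)
Definition residual_cst : R := meval_cst R n s ^+ 2 * (2 ^+ n * level_cst).
(** The contribution off the selected cubes plus that of the change of polynomial on them. *)
Definition good_lambda_cst : R := level_cst `^ q + 2 `^ q * residual_cst `^ q.

Lemma level_cst_ge1 : 1 <= level_cst.
Proof.
have /andP[r0 r1] := r01; rewrite /level_cst -[leLHS](powRr0 2).
apply: ler_powR; first by rewrite ler1n.
by rewrite divr_ge0 ?subr_ge0 ?(ltW r1) ?addr_ge0 ?(ltW q0).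
Qed.

Lemma residual_cst_ge0 : 0 <= residual_cst.
Proof. by rewrite mulr_ge0 ?sqr_ge0 ?mulr_ge0 ?powR_ge0// exprn_ge0. Qed.

Lemma good_lambda_cst_ge0 : 0 <= good_lambda_cst.
Proof. by rewrite addr_ge0// ?mulr_ge0 ?powR_ge0. Qed.

Lemma residual_ge0 Q x : 0 <= u Q x. Proof. exact: normr_ge0. Qed.

Lemma integrable_residual Q Q' : is_cube Q -> Q `<=` X ->
  mu.-integrable Q (EFin \o u Q').
Proof.
move=> cQ QX.
by have := integrable_norm (integrableB_meval (moment_projection s f Q') cQ (fi cQ QX)).
Qed.

Let trunc_ge0 Q x : 0 <= trunc Q x. Proof. exact: powR_ge0. Qed.

Let measurable_trunc Q Q' : is_cube Q -> Q `<=` X ->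
  measurable_fun Q (EFin \o trunc Q').
Proof.
move=> cQ QX; apply/measurable_EFinP.
have /measurable_EFinP mu' : measurable_fun Q (EFin \o u Q').
  exact: measurable_int (integrable_residual Q' cQ QX).
apply: (measurableT_comp (measurable_powR q)).
by apply: measurable_minr => //; exact: measurable_cst.
Qed.

Let volume_W Q : is_cube Q -> Q `<=` X -> 0 < volume Q /\ 0 < W Q.
Proof.
move=> cQ QX; have [_ V0] := cube_measure cQ; split => //.
by apply: lt_le_trans (Wdelta cQ QX); rewrite mulr_gt0.
Qed.

Let trunc_integral_le Q (h : R) A : measurable A -> is_cube Q -> Q `<=` X -> A `<=` Q ->
  0 <= h ->
  {ae mu, forall x, A x -> u Q x <= h} ->
  (\int[mu]_(x in A) (trunc Q x)%:E <= (h `^ q)%:E * mu Q)%E.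
Proof.
move=> mA cQ QX AQ h0 uh; have mQ := cube_measurable cQ.
have hq0 : 0 <= h `^ q by exact: powR_ge0.
apply: (@le_trans _ _ (\int[mu]_(x in A) (h `^ q)%:E)%E).
  apply: (@ae_ge0_le_integral _ _ _ mu A mA).
  - by move=> x _; rewrite lee_fin.
  - exact: measurable_funS mQ AQ (measurable_trunc Q cQ QX).
  - by move=> x _; rewrite lee_fin.
  - exact: measurable_cst.
  - apply: filterS uh => x ux Ax; rewrite lee_fin.
    apply: ge0_ler_powR; rewrite ?nnegrE ?(ltW q0)//.
      by rewrite le_min residual_ge0 ltW.
    by rewrite ge_min ux.
rewrite integral_cst//; apply: lee_wpmul2l; first by rewrite lee_fin.
by apply: le_measure; rewrite ?inE.
Qed.

Let claim M := forall Q, is_cube Q -> Q `<=` X ->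
  (\int[mu]_(x in Q) (trunc Q x)%:E <= (M * size Q)%:E)%E.

(** The truncated integral is at most T^q |Q|, and |Q|^r <= (W(Q) / delta)^r by [Wdelta]. *)
Let initial_claim : claim (T `^ q / delta `^ r).
Proof.
move=> Q cQ QX; have [V0 WQ0] := volume_W cQ QX; have mQ := cube_measurable cQ.
have muQ := (cube_measure cQ).1.
apply: (@le_trans _ _ ((T `^ q)%:E * mu Q)%E).
  rewrite -(integral_cst _ mQ); apply: (@ge0_le_integral _ _ _ mu Q mQ).
  - by move=> x _; rewrite lee_fin.
  - exact: measurable_trunc.
  - exact: measurable_cst.
  - move=> x _; rewrite lee_fin; apply: ge0_ler_powR; rewrite ?nnegrE ?(ltW q0) ?(ltW T0)//.
      by rewrite le_min residual_ge0 ltW.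
    by rewrite ge_min lexx orbT.
rewrite muQ -EFinM lee_fin -mulrA ler_wpM2l ?powR_ge0//.
rewrite ler_pdivlMl ?powR_gt0//.
have {1}-> : volume Q = volume Q `^ (1 - r) * volume Q `^ r.
  by rewrite -powRD ?subrK ?powRr1 ?(ltW V0)// oner_eq0.
rewrite mulrCA ler_wpM2l ?powR_ge0// -powRM ?(ltW d0) ?(ltW V0)//.
have /andP[r0 _] := r01.
apply: ge0_ler_powR; rewrite ?nnegrE ?(ltW r0) ?(ltW WQ0)//; last exact: Wdelta.
by rewrite mulr_ge0 ?ltW.
Qed.

Let improve M : 0 <= M -> claim M -> claim (good_lambda_cst + M / 2).
Proof.
move=> M0 HM Q cQ QX; have [V0 WQ0] := volume_W cQ QX; have mQ := cube_measurable cQ.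
have muQ := (cube_measure cQ).1; have /andP[r0 r1] := r01.
set V := volume Q in V0 *.
(* Used in place of the mean of the residual: it dominates the mean by [Wres], is positive by
   [Wdelta] and so gives a legitimate level, and satisfies a^q V = [size Q]. *)
pose a := (W Q / V) `^ p^-1.
have a0 : 0 < a by rewrite powR_gt0// divr_gt0.
have aqV : a `^ q * V = size Q.
  rewrite /a -powRrM [_ * q]mulrC -/r powRM ?invr_ge0 ?(ltW WQ0) ?(ltW V0)//.
  rewrite /size -/V -mulrA mulrC; congr (_ * _).
  rewrite -powR_inv1 ?(ltW V0)// -powRrM mulN1r -{2}[V]powRr1 ?(ltW V0)//.
  by rewrite -powRD ?(gt_eqF V0) ?implybT// addrC.
have meanQ : \int[mu]_(x in Q) u Q x <= a * V.
  rewrite -ler_pdivrMr// mulrC.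
  set b := _ * _; have b0 : 0 <= b.
    rewrite mulr_ge0 ?invr_ge0 ?(ltW V0)//.
    by apply: Rintegral_ge0 => x _; exact: residual_ge0.
  rewrite -[leLHS](powRr1 b0) -(mulfV (lt0r_neq0 p0)) powRrM /a.
  apply: ge0_ler_powR; rewrite ?nnegrE ?powR_ge0 ?invr_ge0 ?(ltW p0) ?divr_ge0
    ?(ltW V0) ?(ltW WQ0)//.
  by rewrite ler_pdivlMr// mulrC; exact: Wres.
pose lam := level_cst * a.
have L1 := level_cst_ge1; have L0 : 0 < level_cst := lt_le_trans ltr01 L1.
have lam0 : 0 < lam by rewrite mulr_gt0.
have [|F [Fc Ft Fu Fs Fae]] := calderon_zygmund cQ (residual_ge0 Q) lam0
    (integrable_residual Q cQ QX).
  by rewrite (le_trans meanQ)// ler_wpM2r ?(ltW V0)// /lam ler_peMl// ltW.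
have mF m : measurable (F m).
  by have [[->|/cube_measurable//] _] := Fc m; exact: measurable0.
have mUF : measurable (\bigcup_m F m) by exact: bigcupT_measurable.
have FX m : F m `<=` X by have [_ FQ] := Fc m; exact: subset_trans FQ QX.
have vF0 m : 0 <= volume (F m) by rewrite /volume fine_ge0.
have volume0 : volume (set0 : set E) = 0 by rewrite /volume measure0.
have muF m : mu (F m) = (volume (F m))%:E.
  by have [[->|/cube_measure[]//] _] := Fc m; rewrite volume0 measure0.
have WF0 m : 0 <= W (F m).
  have [[->|cF] _] := Fc m; first by rewrite W0.
  by have [_ /ltW] := volume_W cF (FX m).
have sumV k : \sum_(m < k) volume (F m) <= V / level_cst.
  rewrite ler_pdivlMr// mulrC -(ler_pM2l a0) mulrA [a * _]mulrC.
  exact: le_trans (Fs k) meanQ.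
pose H := residual_cst * a.
have H0 : 0 <= H by rewrite mulr_ge0 ?residual_cst_ge0// ltW.
(* Triangle inequality through the projection on [F m]. Its distance to the projection on [Q] is
   controlled by the mean of [u Q] over [F m], at most 2^n lam. *)
have jump m x : F m x -> u Q x <= H + u (F m) x.
  move=> Fx; have [[FE|cF] FQ] := Fc m; first by rewrite FE in Fx.
  have [_ vF] := cube_measure cF.
  have fF := fi cF (FX m).
  have HP := moment_projectionP s cF fF.
  have QP := (moment_projectionP s cQ (fi cQ QX)).1.
  have := moment_projection_sub_le cF fF HP QP Fx.
  set A := ev _ _; set B := ev _ _ => HAB.
  have {HAB} AB : `|A - B| <= H.
    rewrite -(ler_pM2r vF) (le_trans HAB)// /H /residual_cst -[leRHS]mulrA -[leRHS]mulrA.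
    rewrite ler_wpM2l ?sqr_ge0//.
    by apply: (le_trans (Fu m)); rewrite /lam !mulrA.
  change (`|f x - B| <= H + `|f x - A|).
  move: A B (f x) AB => A B y AB.
  have -> : y - B = (A - B) + (y - A) by rewrite [RHS]addrC subrKA.
  by apply: le_trans (ler_normD _ _) _; rewrite lerD2r.
have truncF m : (\int[mu]_(x in F m) (trunc Q x)%:E <=
    (2 `^ q * (H `^ q * volume (F m) + M * size (F m)))%:E)%E.
  have [[FE|cF] FQ] := Fc m.
    rewrite FE integral_set0 lee_fin mulr_ge0 ?powR_ge0//.
    by rewrite addr_ge0 ?mulr_ge0 ?powR_ge0// volume0.
  have mtF := measurable_trunc (F m) cF (FX m).
  have mtFQ := measurable_trunc Q cF (FX m).
  pose c := 2 `^ q : R; have c0 : 0 <= c by exact: powR_ge0.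
  pose h := H `^ q; have h0 : 0 <= h by exact: powR_ge0.
  have mh : measurable_fun (F m) (fun x => h%:E + (trunc (F m) x)%:E)%E.
    by apply: emeasurable_funD mtF; exact: measurable_cst.
  apply: (@le_trans _ _ (\int[mu]_(x in F m)
      (c%:E * (h%:E + (trunc (F m) x)%:E)))%E).
    apply: (@ge0_le_integral _ _ _ mu (F m) (mF m) (EFin \o trunc Q) _ _ mtFQ).
    - by move=> x _; rewrite lee_fin.
    - exact: measurable_funeM.
    move=> x Fx; rewrite -EFinD -EFinM lee_fin.
    have min0 Q' : 0 <= Num.min (u Q' x) T by rewrite le_min residual_ge0 ltW.
    apply: le_trans (powRD_le (ltW q0) H0 (min0 (F m))).
    apply: ge0_ler_powR; rewrite ?nnegrE ?(ltW q0) ?addr_ge0//.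
    (* The jump survives truncation: min(uQ, T) <= H + min(uF, T), also when uF exceeds T. *)
    move: (jump m x Fx); move: (u Q x) (u (F m) x) => uQ uF uQF.
    rewrite ge_min; case: (leP uF T) => _; first by rewrite uQF.
    by apply/orP; right; rewrite lerDr.
  rewrite (ge0_integralZl mu (mF m) mh); last 2 first.
  - by move=> x _; rewrite -EFinD lee_fin addr_ge0.
  - by rewrite lee_fin.
  rewrite EFinM; apply: lee_wpmul2l; first by rewrite lee_fin.
  rewrite (@ge0_integralD _ _ _ mu (F m) (mF m)
    (fun=> h%:E) (EFin \o trunc (F m)) _ _ _ mtF); last 3 first.
  - by move=> x _; rewrite lee_fin.
  - exact: measurable_cst.
  - by move=> x _; rewrite lee_fin.
  rewrite (integral_cst _ (mF m)) muF EFinD -EFinM leeD2l//.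
  exact: HM.
have FQ : \bigcup_m F m `<=` Q by apply: bigcup_sub => m _; exact: (Fc m).2.
have mQF : measurable (Q `\` \bigcup_m F m) by exact: measurableD.
have mtQ := measurable_trunc Q cQ QX.
have t0 A x : A x -> (0 <= (EFin \o trunc Q) x)%E by move=> _; rewrite lee_fin.
have -> : (\int[mu]_(x in Q) (trunc Q x)%:E =
    \int[mu]_(x in Q `\` \bigcup_m F m) (trunc Q x)%:E +
    \int[mu]_(x in \bigcup_m F m) (trunc Q x)%:E)%E.
  rewrite -(@ge0_integral_setU _ _ _ mu _ _ mQF mUF (EFin \o trunc Q)).
  - by rewrite setUC setDUK.
  - by rewrite setUC setDUK.
  - exact: t0.
  - by apply/disj_set2P; apply/seteqP; split => // x [[_ H1] H2]; exact: H1.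
rewrite (@ge0_integral_bigcup _ _ _ mu F (EFin \o trunc Q) mF _ (t0 _) Ft); last first.
  exact: measurable_funS mQ FQ mtQ.
have part1 : (\int[mu]_(x in Q `\` \bigcup_m F m) (trunc Q x)%:E <=
    (level_cst `^ q * size Q)%:E)%E.
  apply: (le_trans (@trunc_integral_le Q lam _ mQF cQ QX (@subDsetl _ _ _) (ltW lam0) _)).
    by apply: filterS Fae => x H1 [Qx Fx]; exact: H1.
  have lamqV : lam `^ q * V = level_cst `^ q * size Q.
    have -> : lam `^ q = level_cst `^ q * a `^ q.
      exact: powRM _ (ltW L0) (ltW a0).
    by rewrite -mulrA; congr (_ * _); exact: aqV.
  by rewrite muQ -EFinM -/V lamqV lexx.
have Linv : (level_cst^-1) `^ (1 - r) = (2 `^ q * 2)^-1.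
  rewrite -powR_inv1 ?(ltW L0)// -powRrM mulN1r powRN; congr (_^-1).
  rewrite /level_cst -powRrM divfK; last by rewrite gt_eqF// subr_gt0.
  by rewrite powRD ?powRr1// pnatr_eq0 implybT.
(* The volumes sum to at most V / [level_cst] and the W(F m) to at most W(Q). The gain cancels the
   factor 2^q of [truncF] and leaves 1/2 in front of [M]. *)
have sumS k : \sum_(m < k) size (F m) <= (2 `^ q * 2)^-1 * size Q.
  have VL0 : 0 < V / level_cst by rewrite divr_gt0.
  apply: (le_trans (sum_powR_le r01 VL0 WQ0 vF0 WF0 (sumV k) (Wsum cQ QX Fc Ft k))).
  by rewrite powRM ?invr_ge0 ?(ltW V0) ?(ltW L0)// Linv /size -/V mulrAC mulrC mulrA.
have part2 : (\sum_(m <oo) \int[mu]_(x in F m) (EFin \o trunc Q) x <=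
    (2 `^ q * residual_cst `^ q * size Q + M / 2 * size Q)%:E)%E.
  apply: lime_le.
    by apply: is_cvg_nneseries => m _ _; apply: integral_ge0 => x _; exact: t0.
  apply: nearW => k; rewrite big_mkord.
  apply: (@le_trans _ _ (\sum_(m < k)
      (2 `^ q * (H `^ q * volume (F m) + M * size (F m)))%R%:E)%E).
    by apply: lee_sum => m _; exact: truncF.
  rewrite sumEFin lee_fin -mulr_sumr big_split/= -!mulr_sumr mulrDr.
  apply: lerD.
    rewrite -!mulrA ler_wpM2l ?powR_ge0// /H powRM ?residual_cst_ge0 ?(ltW a0)//.
    rewrite -mulrA ler_wpM2l ?powR_ge0// -aqV ler_wpM2l ?powR_ge0//.
    by rewrite (le_trans (sumV k))// ler_pdivrMr// ler_peMr// ltW.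
  rewrite mulrCA -mulrA ler_wpM2l//.
  apply: (le_trans (ler_wpM2l _ (sumS k))); first exact: powR_ge0.
  have c0 : 2 `^ q != 0 :> R by rewrite lt0r_neq0// powR_gt0.
  move: (size Q) (2 `^ q) c0 => z c c0.
  by rewrite invfM mulrA mulrA mulfV// mul1r lexx.
apply: (le_trans (leeD part1 part2)).
by rewrite -EFinD lee_fin /good_lambda_cst !mulrDl !addrA.
Qed.

(** 2 K is the fixed point of M -> K + M / 2, so [k] improvements turn 2 K + M0 into 2 K + M0 / 2^k.
    Only M0 depends on [T] and [delta], and it disappears in the limit. *)
Lemma good_lambda Q : is_cube Q -> Q `<=` X ->
  (\int[mu]_(x in Q) ((Num.min (u Q x) T) `^ q)%:E <=
   (2 * good_lambda_cst * ((volume Q) `^ (1 - q / p) * (W Q) `^ (q / p)))%R%:E)%E.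
Proof.
move=> cQ QX; pose M0 := T `^ q / delta `^ r; pose K := good_lambda_cst.
have K0 : 0 <= K by exact: good_lambda_cst_ge0.
have M00 : 0 <= M0 by rewrite divr_ge0 ?powR_ge0.
have claims k : claim (2 * K + M0 / 2 ^+ k).
  elim: k => [|k IH].
    move=> Q' cQ' Q'X; apply: (le_trans (initial_claim cQ' Q'X)).
    rewrite lee_fin ler_wpM2r ?mulr_ge0 ?powR_ge0// expr0 divr1 lerDr mulr_ge0//.
  have H0 : 0 <= 2 * K + M0 / 2 ^+ k.
    by apply: addr_ge0; [exact: mulr_ge0|rewrite divr_ge0// exprn_ge0].
  have := improve H0 IH.
  rewrite (_ : _ + _ / 2 = 2 * K + M0 / 2 ^+ k.+1)//.
  by rewrite exprS -/K; field; rewrite expf_neq0.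
have size0 : 0 <= size Q by rewrite mulr_ge0 ?powR_ge0.
apply/lee_addgt0Pr => e e0; rewrite -EFinD.
pose k := Num.bound ((M0 * size Q) / e).
apply: (le_trans (claims k Q cQ QX)); rewrite lee_fin mulrDl lerD2l.
have := @upper_nthrootP R ((M0 * size Q) / e) k (leqnn _).
rewrite ltr_pdivrMr// => /ltW H.
by rewrite mulrAC ler_pdivrMr ?exprn_gt0// mulrC [e * _]mulrC (le_trans _ H)// mulrC.
Qed.

End good_lambda.

(** * Superadditivity and the comparison of norms *)

(** The suprema are taken one after the other by moving terms to the right of the inequality;
    nonnegativity makes every term finite once [c] is, so the subtractions are legitimate. *)
Lemma ereal_sup_add_le (R : realType) (A B : set (\bar R)) (c : \bar R) :
  A !=set0 -> B !=set0 -> (forall x, A x -> (0 <= x)%E) ->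
  (forall y, B y -> (0 <= y)%E) ->
  (forall x y, A x -> B y -> (x + y <= c)%E) ->
  (ereal_sup A + ereal_sup B <= c)%E.
Proof.
move=> [x0 Ax0] [y0 By0] A0 B0 ABc.
have [->|cy] := eqVneq c +oo%E; first by rewrite leey.
have c0 : (0 <= c)%E.
  by apply: le_trans (ABc _ _ Ax0 By0); apply: adde_ge0; [exact: A0|exact: B0].
have cfin : c \is a fin_num by rewrite ge0_fin_numE// lt_neqAle cy leey.
have fin z : (0 <= z)%E -> (z <= c)%E -> z \is a fin_num.
  by move=> z0 zc; rewrite ge0_fin_numE// (le_lt_trans zc)// -ge0_fin_numE.
have fB y : B y -> y \is a fin_num.
  move=> By; apply: fin (B0 _ By) (le_trans _ (ABc _ _ Ax0 By)).
  by rewrite leeDr// A0.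
have supA y : B y -> (ereal_sup A <= c - y)%E.
  move=> By; apply: ge_ereal_sup => x Ax.
  by rewrite leeBrDr ?fB//; exact: ABc.
have sA0 : (0 <= ereal_sup A)%E by apply: le_trans (A0 _ Ax0) (ereal_sup_ubound Ax0).
have sAfin : ereal_sup A \is a fin_num.
  apply: fin sA0 (le_trans (supA _ By0) _).
  by rewrite leeBlDr ?fB// leeDl// B0.
rewrite -leeBrDl//; apply: ge_ereal_sup => y By.
by rewrite leeBrDl// -leeBrDr ?fB// supA.
Qed.

Section packing.
Context (R : realType) (n : nat).
Local Notation E := (euclidean R n).
Local Notation mu := (lebesgue R n).
Variable t : set E -> \bar R.
Hypothesis t0 : forall Q, (0 <= t Q)%E.
Local Open Scope ereal_scope.

(** For [t] the summand of the norm, this is the p-th power of the norm. [X] is arbitrary rather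
    than a cube, so that superadditivity can be stated for unions. *)
Definition packing (X : set E) : \bar R :=
  ereal_sup [set \esum_(Q in C) t Q | C in disjoint_cubes X].

Lemma disjoint_cubes0 (X : set E) : disjoint_cubes X set0.
Proof. by split => //; exact: trivIset_set0. Qed.

Lemma cube_nonempty (Q : set E) : is_cube Q -> Q !=set0.
Proof.
move=> cQ; have [_ V0] := cube_measure cQ; apply/set0P/eqP => Q0.
by move: V0; rewrite Q0 /volume measure0 ltxx.
Qed.

Lemma packing_ge0 (X : set E) : 0 <= packing X.
Proof.
apply: ereal_sup_ubound; exists set0; first exact: disjoint_cubes0.
by rewrite esum_set0.
Qed.

Lemma packing_set0 : packing set0 = 0.
Proof.
apply/eqP; rewrite eq_le packing_ge0 andbT; apply: ge_ereal_sup => _ [C [CX _] <-].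
rewrite (_ : C = set0) ?esum_set0//; apply/seteqP; split => // Q /CX[cQ Q0].
by have [x /Q0] := cube_nonempty cQ.
Qed.

Lemma le_packing (X Y : set E) : X `<=` Y -> packing X <= packing Y.
Proof.
move=> XY; apply: ereal_sup_le => _ [C [CX CI] <-]; exists C => //; split => //.
by move=> Q /CX[cQ QX]; split => //; exact: subset_trans QX XY.
Qed.

Lemma packing_ge_cube (X Q : set E) : is_cube Q -> Q `<=` X -> t Q <= packing X.
Proof.
move=> cQ QX; apply: ereal_sup_ubound; exists [set Q]; last by rewrite esum_set1.
by split; [move=> _ ->|move=> _ _ -> ->].
Qed.

(** A family in [X] and one in [Y] together form a disjoint family. As cubes are nonempty, no cube
    belongs to both, and the sum over the union splits. *)
Lemma packingU (X Y : set E) : [disjoint X & Y] ->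
  packing X + packing Y <= packing (X `|` Y).
Proof.
move=> /disj_set2P XY0; apply: ereal_sup_add_le.
- by exists (\esum_(Q in set0) t Q), set0 => //; exact: disjoint_cubes0.
- by exists (\esum_(Q in set0) t Q), set0 => //; exact: disjoint_cubes0.
- by move=> _ [C _ <-]; exact: esum_ge0.
- by move=> _ [C _ <-]; exact: esum_ge0.
move=> _ _ [C [CX CI] <-] [D [DY DI] <-]; apply: ereal_sup_ubound.
have CD Q : C Q -> ~ D Q.
  move=> /CX[cQ QX] /DY[_ QY]; have [x Qx] := cube_nonempty cQ.
  have : (X `&` Y) x by split; [exact: QX|exact: QY].
  by rewrite XY0.
exists (C `|` D).
  split.
    move=> Q [/CX[cQ QX]|/DY[cQ QY]]; split => // x Qx; [left|right];
      [exact: QX|exact: QY].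
  have XYD Q Q' : C Q -> D Q' -> Q `&` Q' !=set0 -> Q = Q'.
    move=> /CX[_ QX] /DY[_ QY] [x [/QX Xx /QY Yx]].
    have : (X `&` Y) x by []. by rewrite XY0.
  move=> Q Q' [CQ|DQ] [CQ'|DQ'].
  - exact: CI.
  - exact: XYD.
  - by rewrite setIC => /(XYD _ _ CQ' DQ).
  - exact: DI.
rewrite (esumID C); last by [].
congr (_ + _); congr esum; apply/seteqP; split => Q /=.
- by move=> [].
- by move=> CQ; split => //; left.
- by move=> [[]].
- by move=> DQ; split; [right|move=> /CD].
Qed.

(** The general index serves both uses: initial segments of the sequence of selected cubes, and
    finite families indexed by the cubes themselves. *)
Lemma packing_sum (I : choiceType) (r : seq I) (F : I -> set E) (X : set E) :
  uniq r -> trivIset [set` r] F -> (forall i, i \in r -> F i `<=` X) ->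
  \sum_(i <- r) packing (F i) <= packing X.
Proof.
move=> ur tF FX.
apply: (@le_trans _ _ (packing (\bigcup_(i in [set` r]) F i))); last first.
  by apply: le_packing; apply: bigcup_sub => i /FX.
elim: r ur tF {FX} => [|i r IH] /=; first by rewrite big_nil packing_ge0.
move=> /andP[ir ur] tF; rewrite big_cons.
have tF' : trivIset [set` r] F.
  by apply: sub_trivIset tF => j /= jr; rewrite inE jr orbT.
apply: (le_trans (leeD2l _ (IH ur tF'))).
apply: le_trans (packingU _) _.
  apply/disj_set2P/seteqP; split => // x [Fix [j /= jr Fjx]].
  have ij : i = j.
    apply: tF; rewrite /= ?inE ?eqxx ?jr ?orbT//.
    by exists x.
  by move: ir; rewrite ij jr.
apply: le_packing => x [Fx|[j /= jr Fx]].
  by exists i => //=; rewrite inE eqxx.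
by exists j => //=; rewrite inE jr orbT.
Qed.

End packing.

(** * Jensen's inequality for a single summand *)

Section local_comparison.
Context (R : realType) (n : nat).
Local Notation E := (euclidean R n).
Local Notation mu := (lebesgue R n).
Variables (s : nat) (p q alpha : R) (X : set E) (f : E -> R).
Hypotheses (q1 : 1 <= q) (qp : q < p) (a0 : 0 <= alpha).
Hypothesis fi : forall Q, is_cube Q -> Q `<=` X -> mu.-integrable Q (EFin \o f).
Local Notation u := (residual s f).

Definition jn_term (q' : R) (Q : set E) : \bar R :=
  ((volume Q)%:E * (((volume Q) `^ (- alpha))%:E * campanato_oscillation q' s f Q) `^ p)%E.

Lemma jn_term_ge0 q' Q : (0 <= jn_term q' Q)%E.
Proof.
apply: mule_ge0; last exact: poweR_ge0.
by rewrite lee_fin /volume fine_ge0.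
Qed.

Let q0 : 0 < q. Proof. exact: lt_le_trans ltr01 q1. Qed.
Let p0 : 0 < p. Proof. exact: lt_trans q0 qp. Qed.

(* [jn_term] when the integral of the [q']-th power of the residual is [i]. *)
Definition jn_real (q' : R) (Q : set E) (i : R) : R :=
  volume Q * (volume Q `^ (- alpha) * ((volume Q)^-1 * i) `^ q'^-1) `^ p.

Lemma jn_termE q' Q (i : R) :
  (\int[mu]_(x in Q) (u Q x `^ q')%:E = i%:E)%E -> jn_term q' Q = (jn_real q' Q i)%:E.
Proof.
move=> iE; rewrite /jn_term /campanato_oscillation.
by rewrite (_ : (\int[mu]_(x in Q) _)%E = i%:E).
Qed.

Let meanV Q := (volume Q)^-1 * \int[mu]_(x in Q) u Q x.

Lemma jn_term1E Q : is_cube Q -> Q `<=` X ->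
  jn_term 1 Q = (volume Q * (volume Q `^ (- alpha) * meanV Q) `^ p)%:E.
Proof.
move=> cQ QX; have [muQ V0] := cube_measure cQ.
rewrite (@jn_termE 1 Q (\int[mu]_(x in Q) u Q x)).
  rewrite /jn_real invr1 powRr1// mulr_ge0 ?invr_ge0 ?(ltW V0)//.
  by apply: Rintegral_ge0 => x _; exact: residual_ge0.
under eq_integral do rewrite powRr1 ?residual_ge0//.
rewrite fineK//; apply: integrable_fin_num; first exact: cube_measurable.
exact: (integrable_residual s fi Q cQ QX).
Qed.

Lemma meanV_ge0 Q : is_cube Q -> 0 <= meanV Q.
Proof.
move=> /cube_measure[_ V0]; rewrite mulr_ge0 ?invr_ge0 ?(ltW V0)//.
by apply: Rintegral_ge0 => x _; exact: residual_ge0.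
Qed.

Let measurable_residual Q : is_cube Q -> Q `<=` X -> measurable_fun Q (u Q).
Proof.
move=> cQ QX; apply/measurable_EFinP.
exact: measurable_int (integrable_residual s fi Q cQ QX).
Qed.

Lemma jn_term1_le Q : is_cube Q -> Q `<=` X -> (jn_term 1 Q <= jn_term q Q)%E.
Proof.
move=> cQ QX; have [muQ V0] := cube_measure cQ; have mQ := cube_measurable cQ.
have [m [mE m0 intE]] : exists m, [/\ meanV Q = m, 0 <= m &
    \int[mu]_(x in Q) u Q x = volume Q * m].
  exists (meanV Q); split => //; first exact: meanV_ge0.
  by rewrite /meanV mulVKf// gt_eqF.
have mres := measurable_residual cQ QX.
pose Iq := (\int[mu]_(x in Q) (u Q x `^ q)%:E)%E.
have Iq0 : (0 <= Iq)%E by apply: integral_ge0 => x _; rewrite lee_fin powR_ge0.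
(* The residual need not have an integrable q-th power; then [jn_term q Q] is infinite, all its
   other factors being positive. *)
have [Iqy|Iqfin] := eqVneq Iq +oo%E.
  rewrite {2}/jn_term /campanato_oscillation.
  rewrite (_ : (\int[mu]_(x in Q) _)%E = Iq)// Iqy.
  have powy (c : R) : 0 < c -> (+oo `^ c = +oo :> \bar R)%E.
    by move=> c0; rewrite poweRE (gt_eqF c0) eqxx.
  have muly (c : R) : 0 < c -> (c%:E * +oo = +oo :> \bar R)%E.
    by move=> c0; rewrite gt0_muley.
  by rewrite muly ?invr_gt0// powy ?invr_gt0// muly ?powR_gt0// powy// muly// leey.
have {Iqfin} : Iq \is a fin_num by rewrite ge0_fin_numE// lt_neqAle Iqfin leey.
move=> /fineK IqE; rewrite (jn_termE (esym IqE)) (jn_term1E cQ QX) mE lee_fin /jn_real.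
set i := fine Iq in IqE *; rewrite ler_pM2l//.
have i0 : 0 <= i by rewrite fine_ge0.
suff meanq : m `^ q <= (volume Q)^-1 * i.
  have Va0 := powR_ge0 (volume Q) (- alpha).
  have iq0 := powR_ge0 ((volume Q)^-1 * i) q^-1.
  apply: ge0_ler_powR; rewrite ?nnegrE; [exact: ltW|exact: mulr_ge0|exact: mulr_ge0|].
  rewrite ler_wpM2l//.
  rewrite -{1}[m]powRr1// -(mulfV (lt0r_neq0 q0)) powRrM.
  apply: ge0_ler_powR; rewrite ?nnegrE; [by rewrite invr_ge0 ltW|exact: powR_ge0| |exact: meanq].
  by rewrite mulr_ge0// invr_ge0 ltW.
have ui := integrable_residual s fi Q cQ QX.
have uqi : mu.-integrable Q (EFin \o (fun x => u Q x `^ q)).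
  apply/integrableP; split.
    apply/measurable_EFinP; exact: (measurableT_comp (measurable_powR q)) mres.
  under eq_integral do rewrite /= ger0_norm ?powR_ge0//.
  by rewrite -/Iq -IqE ltry.
have [mz|mnz] := eqVneq m 0.
  by rewrite mz powR0 ?lt0r_neq0// mulr_ge0 ?invr_ge0 ?(ltW V0).
have mgt0 : 0 < m by rewrite lt_def mnz m0.
have [q1E|qn1] := eqVneq q 1.
  rewrite q1E powRr1// -(ler_pM2l V0) -intE mulVKf ?gt_eqF// /i /Iq q1E.
  by under [leRHS]eq_Rintegral do rewrite powRr1 ?residual_ge0//.
have qgt1 : 1 < q by rewrite lt_def qn1 q1.
have r01 : 0 < 1 - q^-1 < 1.
  by rewrite subr_gt0 invf_lt1// qgt1/= ltrBlDr ltrDl invr_gt0.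
(* Young's inequality for u^q and m^q. Integrated with [m] the mean of u, it gives m^q <= (1/q)
   (mean of u^q) + (1 - 1/q) m^q, which is Jensen. It needs 1 - 1/q > 0, whence the separate case q
   = 1. *)
have tangent x : u Q x * m `^ (q - 1) <=
    q^-1 * u Q x `^ q + (1 - q^-1) * m `^ q.
  have := weighted_young r01 (powR_ge0 (u Q x) q) (powR_ge0 (m) q).
  rewrite opprB addrC subrK -!powRrM mulfV ?lt0r_neq0// mulrBr mulr1 mulfV ?lt0r_neq0//.
  by rewrite powRr1// residual_ge0.
pose c := (1 - q^-1) * m `^ q.
have h1 : mu.-integrable Q (EFin \o (fun x => q^-1 * u Q x `^ q)).
  exact: (integrableZl mQ q^-1 uqi).
have h2 : mu.-integrable Q (EFin \o (fun=> c)).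
  by apply: (@le_bounded_integrable _ _ _ mu Q mQ _ `|c|); rewrite ?muQ ?ltry.
have : \int[mu]_(x in Q) (u Q x * m `^ (q - 1)) <=
    \int[mu]_(x in Q) (q^-1 * u Q x `^ q + c).
  apply: (le_Rintegral mQ) => [||x _]; last exact: tangent.
  - exact: (integrableZr mQ (m `^ (q - 1)) ui).
  - exact: (integrableD mQ h1 h2).
rewrite (RintegralZr _ mQ ui) (RintegralD mQ h1 h2) (RintegralZl _ mQ uqi).
rewrite Rintegral_cst// -/(volume Q) intE -mulrA mulr_powRB1// /c.
rewrite -[\int[mu]_(x in Q) _]/i; move: (m `^ q) => z H.
rewrite -(ler_pM2l V0) mulVKf ?gt_eqF//.
have {}H : q^-1 * (volume Q * z) <= q^-1 * i by move: H; rewrite !mulrBl !mul1r; lra.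
by move: H; rewrite ler_pM2l// invr_gt0.
Qed.

End local_comparison.

(** * Bounding a summand with exponent q by the packing of its cube *)

Section reverse_comparison.
Context (R : realType) (n : nat).
Local Notation E := (euclidean R n).
Local Notation mu := (lebesgue R n).
Variables (s : nat) (p q alpha : R) (X : set E) (f : E -> R).
Hypotheses (q1 : 1 <= q) (qp : q < p) (a0 : 0 <= alpha).
Hypothesis fi : forall Q, is_cube Q -> Q `<=` X -> mu.-integrable Q (EFin \o f).
Local Notation u := (residual s f).
Local Notation jn1 := (jn_term s p alpha f 1).

Let q0 : 0 < q. Proof. exact: lt_le_trans ltr01 q1. Qed.
Let p0 : 0 < p. Proof. exact: lt_trans q0 qp. Qed.

(** Monotone convergence along the heights T = m + 1; at each point the truncations are eventually
    constant. *)
Lemma integral_powR_residual_le Q (B : R) : is_cube Q -> Q `<=` X ->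
  (forall T, 0 < T -> (\int[mu]_(x in Q) ((Num.min (u Q x) T) `^ q)%:E <= B%:E)%E) ->
  (\int[mu]_(x in Q) (u Q x `^ q)%:E <= B%:E)%E.
Proof.
move=> cQ QX HB; have mQ := cube_measurable cQ.
have /measurable_EFinP mres := measurable_int _ (integrable_residual s fi Q cQ QX).
pose g (m : nat) (x : E) : \bar R := ((Num.min (u Q x) m.+1%:R) `^ q)%:E.
have gmin0 m x : 0 <= Num.min (u Q x) m.+1%:R by rewrite le_min residual_ge0 ler0n.
have mg m : measurable_fun Q (g m).
  apply/measurable_EFinP; apply: (measurableT_comp (measurable_powR q)).
  by apply: measurable_minr => //; exact: measurable_cst.
have g0 m x : Q x -> (0 <= g m x)%E by move=> _; rewrite lee_fin powR_ge0.
have ndg x : Q x -> {homo g^~ x : m k / (m <= k)%N >-> (m <= k)%E}.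
  move=> _ m k mk; rewrite lee_fin; apply: ge0_ler_powR; rewrite ?nnegrE ?(ltW q0)//.
  by rewrite le_min !ge_min lexx/= ler_nat ltnS mk orbT.
have limg x : Q x -> limn (g^~ x) = (u Q x `^ q)%:E.
  move=> _; apply: lim_near_cst => //.
  exists (Num.bound (u Q x)) => // m /= mb; rewrite /g (elimT min_idPl)//.
  rewrite ltW// (lt_le_trans (archi_boundP (residual_ge0 _ _ _ _)))// ler_nat.
  exact: leq_trans mb (leqnSn _).
rewrite (eq_integral (fun x => limn (g^~ x))); last first.
  by move=> x; rewrite inE => Qx; rewrite limg.
rewrite (monotone_convergence mu mQ mg g0 ndg).
apply: lime_le.
  apply: ereal_nondecreasing_is_cvgn => m k mk.
  apply: (@ge0_le_integral _ _ _ mu Q mQ (g m) (g k) (g0 m) (mg m) (mg k)).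
  by move=> x Qx; exact: ndg.
by apply: nearW => m; apply: HB; rewrite ltr0n.
Qed.

(** The factor 2^(q/p) is the price of splitting off the [delta] term inside a power q/p; the outer
    exponent turns a bound on the q-th power integral into one on a p-th power summand. *)
Definition comparison_cst : R :=
  (2 `^ (q / p) * (2 * good_lambda_cst n s p q)) `^ (p / q).

Lemma jn_term_le_packing Q : is_cube Q -> Q `<=` X -> (packing jn1 Q < +oo)%E ->
  (jn_term s p alpha f q Q <= comparison_cst%:E * packing jn1 Q)%E.
Proof.
move=> cQ QX Noo; have [muQ V0] := cube_measure cQ; have mQ := cube_measurable cQ.
have jn0 Q' : (0 <= jn1 Q')%E by exact: jn_term_ge0.
set V := volume Q in V0 *.
pose r := q / p; have r0 : 0 < r by rewrite divr_gt0.
have r1 : r < 1 by rewrite ltr_pdivrMr// mul1r.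
pose N Y := fine (packing jn1 Y).
have NE Y : Y `<=` Q -> packing jn1 Y = (N Y)%:E.
  move=> YQ; rewrite fineK// ge0_fin_numE ?packing_ge0//.
  exact: le_lt_trans (le_packing _ YQ) Noo.
have N0 Y : 0 <= N Y by rewrite fine_ge0 ?packing_ge0.
(* Since alpha >= 0, [A] dominates |Q'|^(alpha p) for all cubes Q' in [Q], so A times the packing
   bounds the unweighted p-th power mean terms. The weight of [Q] itself divides by [A] again at the
   end, so the constant is free of [Q]. *)
pose A := V `^ (alpha * p); have A0 : 0 < A by rewrite powR_gt0.
pose K := 2 * good_lambda_cst n s p q.
have K0 : 0 <= K by rewrite mulr_ge0 ?good_lambda_cst_ge0.
have fiQ Q' : is_cube Q' -> Q' `<=` Q -> mu.-integrable Q' (EFin \o f).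
  by move=> cQ' Q'Q; apply: fi => //; exact: subset_trans QX.
have main delta T : 0 < delta -> 0 < T ->
    (\int[mu]_(x in Q) ((Num.min (u Q x) T) `^ q)%:E <=
     (K * (V `^ (1 - r) * (A * N Q + delta * V) `^ r))%:E)%E.
  move=> d0 T0; pose W Y := A * N Y + delta * volume Y.
  have volume0 : volume (set0 : set E) = 0 by rewrite /volume measure0.
  apply: (@good_lambda R n s p q Q f q1 qp fiQ W delta T) => //.
  - by rewrite /W /N packing_set0 volume0 !mulr0 addr0.
  - by move=> Q' cQ' Q'Q; rewrite lerDr mulr_ge0// ltW.
  - move=> Q' cQ' Q'Q; have [muQ' V'0] := cube_measure cQ'.
    apply: (@le_trans _ _ (A * N Q')); last by rewrite lerDl mulr_ge0 ?ltW.
    have : (jn1 Q' <= (N Q')%:E)%E.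
      by rewrite -NE//; exact: packing_ge_cube.
    rewrite (jn_term1E _ _ _ fiQ cQ' Q'Q) lee_fin.
    set m := _ * Rintegral _ _ _ => H.
    have m0 : 0 <= m by exact: meanV_ge0.
    have VV' : volume Q' <= V.
      rewrite -lee_fin -muQ -muQ'; apply: le_measure; rewrite ?inE//.
      exact: cube_measurable.
    apply: (@le_trans _ _ (volume Q' `^ (alpha * p) *
        (volume Q' * (volume Q' `^ (- alpha) * m) `^ p))).
      rewrite powRM ?powR_ge0// -powRrM mulNr powRN.
      have := powR_gt0 (alpha * p) V'0; move: (_ `^ (alpha * p)) => c c0.
      rewrite le_eqVlt; apply/orP; left; apply/eqP.
      by move: (volume Q') (m `^ p) => w y; field; rewrite gt_eqF.
    have mA : volume Q' `^ (alpha * p) <= A.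
      apply: ge0_ler_powR; rewrite ?nnegrE; [|exact: ltW|exact: ltW|exact: VV'].
      exact: mulr_ge0 a0 (ltW p0).
    apply: ler_pM; [exact: powR_ge0| |exact: mA|exact: H].
    by apply: mulr_ge0; [exact: ltW|exact: powR_ge0].
  - move=> Q' F cQ' Q'Q HF tF M.
    have mF m : measurable (F m).
      by have [[->|/cube_measurable//] _] := HF m; exact: measurable0.
    have FQ m : F m `<=` Q by have [_ FQ'] := HF m; exact: subset_trans FQ' Q'Q.
    rewrite /W big_split/= -!mulr_sumr lerD// ler_pM2l//.
      rewrite -lee_fin -NE// -sumEFin.
      rewrite (eq_bigr (fun m : 'I_M => packing jn1 (F m))); last by move=> m _; rewrite NE.
      rewrite -(big_mkord xpredT (fun m => packing jn1 (F m))).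
      apply: packing_sum => //; first exact: iota_uniq.
        exact: sub_trivIset tF.
      by move=> m _; exact: (HF m).2.
    rewrite -lee_fin -(cube_measure cQ').1 -sumEFin.
    rewrite (eq_bigr (fun m : 'I_M => mu (F m))); last first.
      move=> m _; have [[->|/cube_measure[]//] _] := HF m.
      by rewrite volume0 measure0.
    rewrite -(measure_bigsetU mu mF tF M).
    apply: le_measure; rewrite ?inE.
    - by apply: bigsetU_measurable => m _; exact: mF.
    - exact: cube_measurable.
    - by rewrite -bigcup_mkord; apply: bigcup_sub => m _; exact: (HF m).2.
pose c1 := 2 `^ r * K; have c10 : 0 <= c1 by rewrite mulr_ge0 ?powR_ge0.
pose z := A * N Q; have z0 : 0 <= z by rewrite mulr_ge0 ?(ltW A0).
pose v := V `^ (1 - r); have v0 : 0 <= v by exact: powR_ge0.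
have bound : (\int[mu]_(x in Q) (u Q x `^ q)%:E <= (c1 * (v * z `^ r))%:E)%E.
  apply: integral_powR_residual_le => // T T0; apply/lee_addgt0Pr => e e0.
  (* With delta = e'^(1/r) / V the extra term (delta V)^r equals e', which enters with the factor c1
     v; the added 1 keeps the denominator positive. *)
  pose e' := e / (c1 * v + 1).
  have cv0 : 0 < c1 * v + 1 by rewrite ltr_wpDl// mulr_ge0.
  have e'0 : 0 < e' by rewrite divr_gt0.
  have d0 : 0 < e' `^ r^-1 / V by rewrite divr_gt0// powR_gt0.
  apply: (le_trans (main _ T d0 T0)); rewrite -EFinD lee_fin divfK ?gt_eqF// -/z -/v.
  have er0 : 0 <= e' `^ r^-1 by exact: powR_ge0.
  apply: (@le_trans _ _ (K * (v * (2 `^ r * (z `^ r + e'))))).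
    rewrite ler_wpM2l// ler_wpM2l//.
    apply: (le_trans (powRD_le (ltW r0) z0 er0)).
    by rewrite -powRrM mulVf ?gt_eqF// powRr1// ltW.
  rewrite (_ : K * _ = c1 * (v * z `^ r) + (c1 * v) * e'); last first.
    by rewrite /c1; move: (z `^ r) (2 `^ r) => *; ring.
  rewrite lerD2l /e' mulrA ler_pdivrMr// mulrC ler_pM2l// lerDl//.
have Iq0 : (0 <= \int[mu]_(x in Q) (u Q x `^ q)%:E)%E.
  by apply: integral_ge0 => x _; rewrite lee_fin powR_ge0.
have : (\int[mu]_(x in Q) (u Q x `^ q)%:E)%E \is a fin_num.
  by rewrite ge0_fin_numE// (le_lt_trans bound)// ltry.
move=> /fineK IE; rewrite (jn_termE _ _ (esym IE)) NE// -EFinM lee_fin.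
move: Iq0 bound; rewrite -IE !lee_fin; move: (fine _) => i i0 ib.
have Vi0 : 0 <= V^-1 by rewrite invr_ge0 ltW.
have zV0 : 0 <= V^-1 * z by rewrite mulr_ge0.
have Vib : V^-1 * i <= c1 * (V^-1 * z) `^ r.
  apply: (le_trans (ler_wpM2l Vi0 ib)); rewrite (powRM r Vi0 z0) mulrCA ler_wpM2l//.
  rewrite mulrA ler_wpM2r ?powR_ge0//.
  rewrite /v -powR_inv1 ?(ltW V0)// -powRrM -powRD ?(gt_eqF V0) ?implybT//.
  by rewrite mulN1r addrA addNr add0r.
have step : (V^-1 * i) `^ q^-1 <= c1 `^ q^-1 * (V^-1 * z) `^ p^-1.
  have -> : (V^-1 * z) `^ p^-1 = ((V^-1 * z) `^ r) `^ q^-1.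
    by rewrite -powRrM /r mulrAC mulfV ?gt_eqF// mul1r.
  rewrite -powRM ?powR_ge0//; apply: ge0_ler_powR; rewrite ?nnegrE ?invr_ge0 ?(ltW q0)//.
    by rewrite mulr_ge0.
  by rewrite mulr_ge0// powR_ge0.
rewrite /jn_real -/V.
apply: (@le_trans _ _ (V * (V `^ (- alpha) * (c1 `^ q^-1 * (V^-1 * z) `^ p^-1)) `^ p)).
  rewrite ler_pM2l//; apply: ge0_ler_powR; rewrite ?nnegrE ?(ltW p0) ?mulr_ge0 ?powR_ge0//.
  by rewrite ler_wpM2l ?powR_ge0.
have powE y : 0 <= y -> (V `^ (- alpha) * (c1 `^ q^-1 * y `^ p^-1)) `^ p =
    A^-1 * (c1 `^ (p / q) * y).
  move=> y0; rewrite (powRM p (powR_ge0 _ _) (mulr_ge0 (powR_ge0 _ _) (powR_ge0 _ _))).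
  rewrite (powRM p (powR_ge0 _ _) (powR_ge0 _ _)) -!powRrM mulVf ?gt_eqF//.
  by rewrite powRr1// mulNr powRN [q^-1 * p]mulrC.
rewrite (powE _ zV0) /comparison_cst -/K -/r -/c1 /z.
move: (c1 `^ (p / q)) (N Q) => c b; rewrite le_eqVlt; apply/orP; left; apply/eqP.
have cancel_ (x y : R) : x != 0 -> y != 0 -> y * (x^-1 * (c * (y^-1 * (x * b)))) = c * b.
  by move=> x0 y0; field; rewrite x0 y0.
by apply: cancel_; rewrite lt0r_neq0.
Qed.

End reverse_comparison.

(** * Comparison of the norms *)

Section JN_comparison.
Context (R : realType) (n : nat).
Local Notation E := (euclidean R n).
Local Notation mu := (lebesgue R n).
Variables (X : set E) (s : nat) (p q alpha : R) (f : E -> R).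
Hypotheses (mX : measurable X) (q1 : 1 <= q) (qp : q < p) (a0 : 0 <= alpha).
Hypothesis fX : L1loc X f.

Let p0 : 0 < p. Proof. exact: lt_trans (lt_le_trans ltr01 q1) qp. Qed.

Let fi Q : is_cube Q -> Q `<=` X -> mu.-integrable Q (EFin \o f).
Proof.
move=> cQ QX; have mQ := cube_measurable cQ.
have [_ /(_ Q mQ QX (cube_bounded cQ)) fQ] := fX.
apply: (eq_integrable mQ (fun x => (f x * \1_Q x)%:E)).
  by move=> x xQ; rewrite /= indicE xQ mulr1.
exact: integrableS mX mQ QX fQ.
Qed.

Lemma JN_normE q' : JN_norm X p q' s alpha f =
  (packing (jn_term s p alpha f q') X `^ p^-1)%E.
Proof. by []. Qed.

Let le_root (x y : \bar R) : (0 <= x)%E -> (x <= y)%E -> (x `^ p^-1 <= y `^ p^-1)%E.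
Proof.
move=> x0 xy; apply: gt0_ler_poweR => //; first by rewrite invr_ge0 ltW.
  by rewrite in_itv/= x0 leey.
by rewrite in_itv/= (le_trans x0 xy) leey.
Qed.

Lemma JN_norm1_le : (JN_norm X p 1 s alpha f <= JN_norm X p q s alpha f)%E.
Proof.
rewrite !JN_normE; apply: le_root.
  by apply: packing_ge0 => Q; exact: jn_term_ge0.
apply: ge_ereal_sup => _ [C CX <-]; apply: le_ereal_sup_tmp.
exists (\esum_(Q in C) jn_term s p alpha f q Q)%E; first by exists C.
by apply: le_esum => Q /CX.1[cQ QX]; exact: jn_term1_le fi _ _ _.
Qed.

(** The summands are bounded by packings of disjoint cubes, whose sum is at most the packing of [X].
    Adding 1 to [comparison_cst] makes the constant visibly positive, as the equivalence of norms
    requires. *)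
Lemma JN_norm_le_norm1 : (JN_norm X p 1 s alpha f < +oo)%E ->
  (JN_norm X p q s alpha f <=
   ((comparison_cst n s p q + 1) `^ p^-1)%:E * JN_norm X p 1 s alpha f)%E.
Proof.
rewrite !JN_normE; set N := packing _ X => Noo.
have jn0 Q : (0 <= jn_term s p alpha f 1 Q)%E by exact: jn_term_ge0.
have N0 : (0 <= N)%E by exact: packing_ge0.
have {}Noo : (N < +oo)%E.
  rewrite ltey; apply: contraTneq Noo => ->.
  by rewrite poweRE invr_eq0 gt_eqF//= eqxx ltxx.
pose K := comparison_cst n s p q.
have K0 : 0 <= K by exact: powR_ge0.
have K10 : (0 <= (K + 1)%:E)%E by rewrite lee_fin addr_ge0.
rewrite -poweR_EFin -(poweRM _ K10 N0).
apply: le_root.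
  by apply: packing_ge0 => Q; exact: jn_term_ge0.
apply: ge_ereal_sup => _ [C [CX CI] <-].
(* [\esum] is a supremum over finite subfamilies [D], to which [packing_sum] applies. *)
apply: ge_ereal_sup => _ [D [fD DC] <-]; rewrite fsbig_finite//.
apply: (@le_trans _ _ (\sum_(Q <- finmap.enum_fset (fset_set D))
    (K%:E * packing (jn_term s p alpha f 1) Q))%E).
  rewrite big_seq [leRHS]big_seq; apply: lee_sum => Q.
  rewrite in_fset_set// inE => /DC/CX[cQ QX].
  apply: (jn_term_le_packing q1 qp a0 fi cQ QX).
  exact: le_lt_trans (le_packing _ QX) Noo.
rewrite -ge0_sume_distrr; last by move=> Q _; exact: packing_ge0.
apply: (@le_trans _ _ (K%:E * N)%E); last first.
  by apply: lee_wpmul2r => //; rewrite lee_fin lerDl.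
apply: lee_wpmul2l; first by rewrite lee_fin.
apply: (packing_sum jn0).
- exact: finmap.fset_uniq.
- by apply: sub_trivIset CI => Q /=; rewrite in_fset_set// inE; exact: DC.
- by move=> Q; rewrite in_fset_set// inE => /DC/CX[].
Qed.

End JN_comparison.

Theorem proposition1p19 (R : realType) (n : nat) (X : set (euclidean R n))
  (p q : R) (s : nat) (alpha : R) :
  (0 < n)%N ->
  X = setT \/ is_closed_cube X ->
  1 <= q -> q < p -> 0 <= alpha ->
  JN X p q s alpha = JN X p 1 s alpha /\
  exists c C : R, [/\ 0 < c, 0 < C &
    forall f, JN X p q s alpha f ->
      (c%:E * JN_norm X p 1 s alpha f <= JN_norm X p q s alpha f)%E /\
      (JN_norm X p q s alpha f <= C%:E * JN_norm X p 1 s alpha f)%E].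
Proof.
move=> _ XE q1 qp a0.
have mX : measurable X.
  case: XE => [->|[a [l [l0 ->]]]]; first exact: measurableT.
  by apply: cube_measurable; exists a, l, (fun=> true), (fun=> false).
have C0 : 0 < (comparison_cst n s p q + 1) `^ p^-1.
  by rewrite powR_gt0// ltr_wpDl// powR_ge0.
split.
  apply/seteqP; split => f [fX fN]; split => //.
    exact: le_lt_trans (JN_norm1_le s alpha mX q1 qp fX) fN.
  apply: le_lt_trans (JN_norm_le_norm1 mX q1 qp a0 fX fN) _.
  by rewrite lte_mul_pinfty// lee_fin ltW.
(* Jensen gives the lower constant 1, and also the finiteness of the norm with exponent 1 that the
   upper bound requires. *)
exists 1, ((comparison_cst n s p q + 1) `^ p^-1); split => // f [fX fN].
have N1 := JN_norm1_le s alpha mX q1 qp fX; rewrite mul1e; split => //.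
exact: JN_norm_le_norm1 mX q1 qp a0 fX (le_lt_trans N1 fN).
Qed.
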